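(* Let $(K,v)$ be a maximal field and $(L,v)$ a transcendental extension of $(K,v)$ of finite transcendence degree. Assume that $Lv|Kv$ is separable-algebraic and that $vL/vK$ is a torsion group such that the characteristic of $Kv$ does not divide the orders of its elements. Then $Lv|Kv$ or $vL/vK$ is infinite, and every maximal immediate extension of $(L,v)$ has infinite transcendence degree over $L$.
   Context: For a valued field $(K,v)$ (Krull valuation, written additively), $vK$ denotes the value group and $Kv$ the residue field. In a valued field extension $(L|K,v)$, $K$ carries the restriction of $v$ from $L$. The extension is immediate if the canonical embeddings $vK\hookrightarrow vL$ and $Kv\hookrightarrow Lv$ are onto. A valued field is maximal if it admits no proper immediate extension; a maximal immediate extension of $(L,v)$ is an immediate extension of $(L,v)$ which is a maximal field. If $\mathrm{char}\,Kv=0$, the condition on orders of elements is vacuous. *)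

(* Defs.v *)
From HB Require Import structures.
From mathcomp Require Import all_boot all_order all_algebra all_field.
From mathcomp Require Import ring_quotient.
From mathcomp Require Import boolp.
From mathcomp Require Import mpoly.
Set Implicit Arguments.
Unset Strict Implicit.
Unset Printing Implicit Defensive.
Import Order.TTheory GRing.Theory.
Local Open Scope ring_scope.
Local Open Scope quotient_scope.

HB.mixin Record POrderedZmodule_isOrderedGroup G of Num.POrderedZmodule G := {
  oag_total : forall x y : G, (x <= y) || (y <= x);
  oag_leD2l : forall z x y : G, x <= y -> z + x <= z + y
}.

#[short(type="oagType")]
HB.structure Definition OrderedGroup :=
  { G of Num.POrderedZmodule G & POrderedZmodule_isOrderedGroup G }.

Lemma oag_comparable (G : oagType) (x y : G) : x >=< y.
Proof. exact: oag_total. Qed.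

Lemma oag_ltNge (G : oagType) (x y : G) : (x < y) = ~~ (y <= x).
Proof. by rewrite (comparable_leNgt (oag_comparable y x)) negbK. Qed.

(* Krull valuations, written additively.  [vval] is only meaningful on nonzero
   elements: the usual convention v 0 = oo is replaced by treating 0 apart, and
   [vval 0] is a junk value.  By surjectivity [vgroup] is the value group. *)
Record valuedField := ValuedField {
  vfield :> fieldType;
  vgroup : oagType;
  vval : vfield -> vgroup;
  vvalM : forall x y, x != 0 -> y != 0 -> vval (x * y) = vval x + vval y;
  vvalD : forall x y, x != 0 -> y != 0 -> x + y != 0 ->
    Order.min (vval x) (vval y) <= vval (x + y);
  vval_surj : forall g, exists2 x, x != 0 & vval x = g
}.

Section ResidueField.
Variable K : valuedField.
Implicit Types x y : K.

Lemma vval1 : vval (1 : K) = 0.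
Proof.
have := vvalM (oner_neq0 K) (oner_neq0 K).
by rewrite mulr1 => /(congr1 (fun g => g - vval 1)); rewrite addrK subrr.
Qed.

Lemma vvalV x : x != 0 -> vval x^-1 = - vval x.
Proof.
move=> x0; have xV0 : x^-1 != 0 by rewrite invr_eq0.
by apply/eqP; rewrite -addr_eq0 -vvalM // mulVf // vval1.
Qed.

Lemma vvalN x : vval (- x) = vval x.
Proof.
have [->|x0] := eqVneq x 0; first by rewrite oppr0.
have N1 : (-1 : K) != 0 by rewrite oppr_eq0 oner_eq0.
rewrite -mulN1r vvalM //.
suff -> : vval (-1 : K) = 0 by rewrite add0r.
have H : vval (-1 : K) + vval (-1 : K) = 0 by rewrite -vvalM // mulrNN mulr1 vval1.
set a := vval (-1 : K) in H *.
have [a0|a0] := comparable_leP (oag_comparable 0 a).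
  by have := oag_leD2l a _ _ a0; rewrite addr0 H => aN; apply/le_anti; rewrite aN.
by have := oag_leD2l a _ _ (ltW a0); rewrite addr0 H => aP; apply/le_anti;
  rewrite aP ltW.
Qed.

Definition vring_pred : {pred K} := fun x => (x == 0) || (0 <= vval x).

Lemma vring_subring : subring_closed vring_pred.
Proof.
rewrite /vring_pred; split=> [|x y|x y]; rewrite /in_mem /=.
- by rewrite vval1 lexx orbT.
- have [->|x0] := eqVneq x 0; first by rewrite sub0r oppr_eq0 vvalN.
  have [->|y0] := eqVneq y 0; first by rewrite subr0 (negPf x0).
  have [//|xy0] := eqVneq (x - y) 0 => /= vx vy.
  have := vvalD x0 _ xy0; rewrite oppr_eq0 vvalN => /(_ y0).
  by apply: le_trans; rewrite comparable_le_min ?oag_comparable ?vx.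
- have [->|x0] := eqVneq x 0; first by rewrite mul0r eqxx.
  have [->|y0] := eqVneq y 0; first by rewrite mulr0 eqxx.
  rewrite vvalM // => /= vx vy; apply/orP; right; apply: (le_trans vx).
  by rewrite -{1}[vval x]addr0; apply: oag_leD2l.
Qed.

HB.instance Definition _ := GRing.isSubringClosed.Build K vring_pred vring_subring.

Record vring := VRing { vring_val : K; _ : vring_val \in vring_pred }.

HB.instance Definition _ := [isSub for vring_val].
HB.instance Definition _ := [Choice of vring by <:].
HB.instance Definition _ := [SubChoice_isSubComNzRing of vring by <:].

Definition vmax : {pred vring} :=
  fun a => (vring_val a == 0) || (0 < vval (vring_val a)).

Lemma vmaxP (a : vring) : reflect
  (forall b : vring, vring_val a * vring_val b != 1) (a \in vmax).
Proof.
rewrite /in_mem /= /vmax; apply: (iffP idP) => [+ b|H].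
  have [a0 _|a0 /= va] := eqVneq (vring_val a) 0.
    by rewrite a0 mul0r eq_sym oner_eq0.
  apply/eqP => ab1; have b0 : vring_val b != 0.
    by apply: contra_eq_neq ab1 => ->; rewrite mulr0 eq_sym oner_eq0.
  have := vvalM a0 b0; rewrite ab1 vval1 => /eqP.
  rewrite eq_sym addr_eq0 => /eqP E; move: va; rewrite E.
  have := valP b; rewrite /vring_pred /in_mem /= (negPf b0) /= => vb va.
  have := oag_leD2l (- vval (vring_val b)) _ _ vb.
  by rewrite addr0 addNr => /(lt_le_trans va); rewrite ltxx.
have [//|a0 /=] := eqVneq (vring_val a) 0.
rewrite oag_ltNge; apply/negP => va.
have bP : (vring_val a)^-1 \in vring_pred.
  rewrite /in_mem /= /vring_pred vvalV //; apply/orP; right.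
  by have := oag_leD2l (- vval (vring_val a)) _ _ va; rewrite addr0 addNr.
by have := H (VRing bP); rewrite /= mulfV // eqxx.
Qed.

Lemma vmax_idealr : idealr_closed vmax.
Proof.
split=> [||c a b].
- by rewrite /in_mem /= /vmax eqxx.
- by apply/vmaxP => /(_ 1); rewrite mulr1 eqxx.
- move=> /vmaxP ha hb.
  have hca : c * a \in vmax.
    by apply/vmaxP => d; have := ha (c * d); rewrite mulrCA mulrA.
  move: hca hb; rewrite /in_mem /= /vmax; move: (c * a) => {ha a c} a.
  rewrite -[vring_val (a + b)]/(vring_val a + vring_val b).
  have [->|a0] := eqVneq (vring_val a) 0; first by rewrite add0r.
  have [->|b0] := eqVneq (vring_val b) 0; first by rewrite addr0 (negPf a0).
  have [//|ab0] /= := eqVneq (vring_val a + vring_val b) 0 => va vb.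
  by apply: lt_le_trans (vvalD a0 b0 ab0);
    rewrite comparable_lt_min ?oag_comparable ?va.
Qed.

HB.instance Definition _ := isIdealr.Build vring vmax vmax_idealr.

Definition residue := {ideal_quot vmax}.
HB.instance Definition _ := GRing.ComNzRing.on residue.

Definition res (a : vring) : residue := \pi_{ideal_quot vmax} a.

Lemma res_is_zmod : zmod_morphism res.
Proof. by move=> a b; apply: (rmorphB \pi_{ideal_quot vmax}). Qed.
Lemma res_is_monoid : monoid_morphism res.
Proof.
split; first exact: (rmorph1 \pi_{ideal_quot vmax}).
by move=> a b; apply: (rmorphM \pi_{ideal_quot vmax}).
Qed.
HB.instance Definition _ := GRing.isZmodMorphism.Build vring residue res res_is_zmod.
HB.instance Definition _ :=
  GRing.isMonoidMorphism.Build vring residue res res_is_monoid.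

Definition residue_inv (u : residue) : residue :=
  if u == 0 then 0 else res (insubd 0 (vring_val (repr u))^-1).

Lemma resE (a b : vring) : (res a == res b) = (a - b \in vmax).
Proof. by rewrite Quotient.idealrBE. Qed.

Lemma residue_mulVf (u : residue) : u != 0 -> residue_inv u * u = 1.
Proof.
move=> u0; rewrite /residue_inv (negPf u0).
set a := repr u; have ua : u = res a by rewrite /res reprK.
have aM : a \notin vmax.
  by move: u0; rewrite ua -[0](rmorph0 res) resE subr0.
have /existsNP[b /negP] : ~ forall b : vring, vring_val a * vring_val b != 1.
  by move/vmaxP; apply/negP.
rewrite negbK => /eqP ab1.
have -> : insubd 0 (vring_val a)^-1 = b.
  have a0 : vring_val a != 0.
    by apply: contra_eq_neq ab1 => ->; rewrite mul0r eq_sym oner_eq0.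
  have -> : (vring_val a)^-1 = val b by rewrite -[RHS](mulKf a0) ab1 mulr1.
  by rewrite valKd.
rewrite ua -rmorphM -[RHS](rmorph1 res).
by congr (res _); apply: val_inj; rewrite /= mulrC.
Qed.

Lemma residue_inv0 : residue_inv 0 = 0.
Proof. by rewrite /residue_inv eqxx. Qed.

HB.instance Definition _ :=
  GRing.ComNzRing_isField.Build residue residue_mulVf residue_inv0.

End ResidueField.

(* [vext_group] is the canonical embedding of value groups; it is determined by
   [vext_fun], and [vext_val] says that the valuation of K is the restriction of
   that of L along the embedding [vext_fun]. *)
Record vext (K L : valuedField) := VExt {
  vext_fun :> {rmorphism K -> L};
  vext_group : {additive vgroup K -> vgroup L};
  vext_mono : {mono vext_group : g h / g <= h};
  vext_val : forall x : K, x != 0 -> vval (vext_fun x) = vext_group (vval x)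
}.

Section ExtensionMaps.
Variables (K L : valuedField) (e : vext K L).

Lemma vext_vring (a : vring K) : e (vring_val a) \in @vring_pred L.
Proof.
case: a => x /=; rewrite /in_mem /= /vring_pred fmorph_eq0.
have [//|x0 /= vx] := eqVneq x 0.
by rewrite vext_val // -(raddf0 (vext_group e)) vext_mono.
Qed.

Definition vext_int (a : vring K) : vring L := VRing (vext_vring a).

Lemma vext_int_is_zmod : zmod_morphism vext_int.
Proof. by move=> a b; apply: val_inj; rewrite /= rmorphB. Qed.
Lemma vext_int_is_monoid : monoid_morphism vext_int.
Proof. by split=> [|a b]; apply: val_inj; rewrite /= ?rmorph1 ?rmorphM. Qed.
HB.instance Definition _ :=
  GRing.isZmodMorphism.Build (vring K) (vring L) vext_int vext_int_is_zmod.
HB.instance Definition _ :=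
  GRing.isMonoidMorphism.Build (vring K) (vring L) vext_int vext_int_is_monoid.

(* Defined on chosen representatives; [vext_resE] shows that the choice does
   not matter. *)
Definition vext_res (u : residue K) : residue L := res (vext_int (repr u)).

Lemma vext_resE (a : vring K) : vext_res (res a) = res (vext_int a).
Proof.
apply/eqP; rewrite resE -rmorphB.
have : repr (res a) - a \in @vmax K by rewrite -resE /res reprK.
move: (_ - a) => {}a; rewrite /in_mem /= /vmax /= fmorph_eq0.
have [//|a0 /= va] := eqVneq (vring_val a) 0.
by rewrite vext_val // -(raddf0 (vext_group e)) (leW_mono (@vext_mono _ _ e)).
Qed.

Lemma residueP (F : valuedField) (u : residue F) : exists a, u = res a.
Proof. by exists (repr u); rewrite /res reprK. Qed.

Lemma vext_res_is_zmod : zmod_morphism vext_res.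
Proof.
move=> u w; have [a ->] := residueP u; have [b ->] := residueP w.
by rewrite !vext_resE -!rmorphB vext_resE.
Qed.
Lemma vext_res_is_monoid : monoid_morphism vext_res.
Proof.
split=> [|u w]; first by rewrite -[1](rmorph1 (@res K)) vext_resE !rmorph1.
have [a ->] := residueP u; have [b ->] := residueP w.
by rewrite !vext_resE -!rmorphM vext_resE.
Qed.
HB.instance Definition _ :=
  GRing.isZmodMorphism.Build (residue K) (residue L) vext_res vext_res_is_zmod.
HB.instance Definition _ :=
  GRing.isMonoidMorphism.Build (residue K) (residue L) vext_res vext_res_is_monoid.

Definition vext_group_range : {pred vgroup L} :=
  fun g => `[< exists h, g = vext_group e h >].

Lemma vext_group_range_zmod : zmod_closed vext_group_range.
Proof.
split=> [|g h]; first by apply/asboolP; exists 0; rewrite raddf0.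
by move=> /asboolP[g' ->] /asboolP[h' ->]; apply/asboolP;
  exists (g' - h'); rewrite raddfB.
Qed.
HB.instance Definition _ :=
  GRing.isZmodClosed.Build (vgroup L) vext_group_range vext_group_range_zmod.

Definition vext_quot := Quotient.quot vext_group_range.
HB.instance Definition _ := GRing.Zmodule.on vext_quot.

Definition immediate : Prop :=
  (forall h : vgroup L, exists g, vext_group e g = h) /\
  (forall w : residue L, exists u, vext_res u = w).

End ExtensionMaps.

(* A proper extension is one whose embedding is not onto. *)
Definition maximal_valued (K : valuedField) : Prop :=
  forall (L : valuedField) (e : vext K L),
    immediate e -> forall y : L, exists x : K, e x = y.

Section FieldExtensions.
Variables (F E : fieldType) (f : {rmorphism F -> E}).

Definition transcendental_ext : Prop := ~ forall x : E, algebraicOver f x.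

Definition separable_algebraic_ext : Prop :=
  forall x : E, exists p : {poly F},
    [/\ irreducible_poly p, separable_poly p & root (map_poly f p) x].

Definition finite_ext : Prop :=
  exists (n : nat) (b : 'I_n -> E),
    forall x : E, exists c : 'I_n -> F, x = \sum_i f (c i) * b i.

Definition alg_independent (n : nat) (t : 'I_n -> E) : Prop :=
  forall p : {mpoly F[n]}, mmap f t p = 0 -> p = 0.

(* The transcendence degree is the greatest cardinality of an algebraically
   independent family. *)
Definition has_trdeg (d : nat) : Prop :=
  (exists t : 'I_d -> E, alg_independent t) /\
  (forall (n : nat) (t : 'I_n -> E), alg_independent t -> (n <= d)%N).

Definition finite_trdeg : Prop := exists d, has_trdeg d.

End FieldExtensions.

Section Groups.
Variable G : zmodType.

Definition is_order (a : G) (n : nat) : Prop :=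
  [/\ (0 < n)%N, a *+ n = 0 &
      forall m, (0 < m)%N -> a *+ m = 0 -> (n <= m)%N].

Definition torsion_group : Prop := forall a : G, exists n, is_order a n.

Definition finite_group : Prop := exists s : seq G, forall a, a \in s.

End Groups.

(* Main.v *)
(* By Kaplansky, a maximal field is spherically complete, so every finite dimensional
   K-subspace of an extension has best approximations.
   If Lv|Kv and vL/vK were both finite, lifts of generators would span a K-subspace
   in which no element of L outside it has a best approximation; so L would be finite
   over K.
   For the second assertion let M be a maximal immediate extension of L.  The distance
   of a vector from a finite dimensional K-subspace not containing it is positive, so
   K-linear independence of finitely many polynomial expressions in x is an open
   condition on x in M.  Given independent elements t of L over K and s of M over L,
   perturb successively by small multiples of high powers of t_0: at step D the
   monomials of degree < D in (t, s, x) become K-linearly independent and remain so in a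
   ball.  The balls are nested and spherical completeness of M gives x transcendental
   over K(t, s).  When t and s are maximal independent families this is absurd. *)

Require Import Defs.
From HB Require Import structures.
From mathcomp Require Import all_boot all_order all_algebra all_field.
From mathcomp Require Import ring_quotient boolp mpoly ring zify.
Set Implicit Arguments.
Unset Strict Implicit.
Unset Printing Implicit Defensive.
Import Order.TTheory GRing.Theory.
Local Open Scope ring_scope.

(** * The order of absolute values *)

(* [vle x y] is |x| <= |y| in multiplicative notation, which covers 0. *)
Definition vle (K : valuedField) (x y : K) : bool :=
  (x == 0) || ((y != 0) && (vval y <= vval x)).

Definition vlt (K : valuedField) (x y : K) : bool := ~~ vle y x.

Section NormOrder.
Variable K : valuedField.
Implicit Types x y z t : K.

Lemma oag_le2D (G : oagType) (z x y : G) : (z + x <= z + y) = (x <= y).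
Proof.
apply/idP/idP; last exact: oag_leD2l.
by move/(oag_leD2l (- z)); rewrite !addKr.
Qed.

Lemma oag_leD (G : oagType) (x y z t : G) : x <= y -> z <= t -> x + z <= y + t.
Proof.
by move=> xy zt; apply: le_trans (oag_leD2l x _ _ zt) _; rewrite ![_ + t]addrC oag_le2D.
Qed.

Lemma vleE x y : x != 0 -> y != 0 -> vle x y = (vval y <= vval x).
Proof. by rewrite /vle => /negPf-> ->. Qed.

Lemma vltE x y : x != 0 -> y != 0 -> vlt x y = (vval y < vval x).
Proof. by move=> x0 y0; rewrite /vlt vleE // oag_ltNge. Qed.

Lemma vle0x x : vle 0 x.
Proof. by rewrite /vle eqxx. Qed.

Lemma vlex0 x : vle x 0 = (x == 0).
Proof. by rewrite /vle eqxx orbF. Qed.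

Lemma vle_refl x : vle x x.
Proof. by rewrite /vle lexx andbT orbN. Qed.

Lemma vle_total x y : vle x y || vle y x.
Proof.
have [->|x0] := eqVneq x 0; first by rewrite vle0x.
have [->|y0] := eqVneq y 0; first by rewrite vle0x orbT.
by rewrite !vleE // oag_total.
Qed.

Lemma vle_trans y x z : vle x y -> vle y z -> vle x z.
Proof.
have [->|x0] := eqVneq x 0; first by rewrite !vle0x.
have [->|y0] := eqVneq y 0; first by rewrite vlex0 (negPf x0).
have [->|z0] := eqVneq z 0; first by rewrite (vlex0 y) (negPf y0).
by rewrite !vleE // => xy yz; apply: le_trans yz xy.
Qed.

Lemma vltW x y : vlt x y -> vle x y.
Proof. by move=> xy; case/orP: (vle_total x y) => // yx; rewrite /vlt yx in xy. Qed.

Lemma vle_lt_trans y x z : vle x y -> vlt y z -> vlt x z.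
Proof. by move=> xy; apply: contra => zx; apply: vle_trans zx xy. Qed.

Lemma vlt_le_trans y x z : vlt x y -> vle y z -> vlt x z.
Proof. by move=> + yz; apply: contra => /(vle_trans yz). Qed.

Lemma vltxx x : vlt x x = false.
Proof. by rewrite /vlt vle_refl. Qed.

Lemma vlt_neq0 x y : vlt x y -> y != 0.
Proof. by apply: contraNneq => ->; apply: vle0x. Qed.

Lemma vlt0x x : vlt 0 x = (x != 0).
Proof. by rewrite /vlt vlex0. Qed.

Lemma vleNx x y : vle (- x) y = vle x y.
Proof. by rewrite /vle oppr_eq0 vvalN. Qed.

Lemma vlexN x y : vle x (- y) = vle x y.
Proof. by rewrite /vle oppr_eq0 vvalN. Qed.

Lemma vleD x y z : vle x z -> vle y z -> vle (x + y) z.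
Proof.
have [->|x0] := eqVneq x 0; first by rewrite add0r.
have [->|y0] := eqVneq y 0; first by rewrite addr0.
have [->|z0] := eqVneq z 0; first by rewrite !vlex0 (negPf x0).
have [->|xy0] := eqVneq (x + y) 0; first by rewrite vle0x.
rewrite !vleE // => zx zy; apply: le_trans (vvalD x0 y0 xy0).
by rewrite comparable_le_min ?oag_comparable ?zx.
Qed.

Lemma vleB x y z : vle x z -> vle y z -> vle (x - y) z.
Proof. by move=> xz yz; apply: vleD; rewrite ?vleNx. Qed.

Lemma vltD x y z : vlt x z -> vlt y z -> vlt (x + y) z.
Proof.
move=> xz yz; case/orP: (vle_total x y) => xy.
  by apply: vle_lt_trans yz; apply: vleD; rewrite ?vle_refl.
by apply: vle_lt_trans xz; apply: vleD; rewrite ?vle_refl.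
Qed.

Lemma vltNx x y : vlt (- x) y = vlt x y.
Proof. by rewrite /vlt vlexN. Qed.

Lemma vltB x y z : vlt x z -> vlt y z -> vlt (x - y) z.
Proof. by move=> xz yz; apply: vltD; rewrite ?vltNx. Qed.

Lemma vltBC x y z : vlt (x - y) z = vlt (y - x) z.
Proof. by rewrite -vltNx opprB. Qed.

(** Isosceles principle: an error smaller than x leaves the absolute value unchanged. Equality is
    expressed by two inequalities, so that 0 needs no separate treatment. *)
Lemma vlt_subr_eq x y : vlt (x - y) x -> vle x y /\ vle y x.
Proof.
move=> h; split; last by rewrite -(subKr x y) vleB ?vle_refl ?vltW.
apply: contraTT h => yx; have {}yx : vlt y x by [].
rewrite /vlt negbK; apply/negPn/negP => h.
by have := vltD h yx; rewrite subrK vltxx.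
Qed.

Lemma vle_pM2r z x y : z != 0 -> vle (x * z) (y * z) = vle x y.
Proof.
move=> z0; have [->|x0] := eqVneq x 0; first by rewrite mul0r !vle0x.
have [->|y0] := eqVneq y 0; first by rewrite mul0r !vlex0 mulf_eq0 (negPf z0) orbF.
by rewrite !vleE ?mulf_neq0 // !vvalM // ![_ + vval z]addrC oag_le2D.
Qed.

Lemma vlt_pM2r z x y : z != 0 -> vlt (x * z) (y * z) = vlt x y.
Proof. by move=> z0; rewrite /vlt vle_pM2r. Qed.

Lemma vle_M2r z x y : vle x y -> vle (x * z) (y * z).
Proof.
have [->|z0] := eqVneq z 0; first by rewrite !mulr0 vle0x.
by rewrite vle_pM2r.
Qed.

Lemma vle_M x y z t : vle x y -> vle z t -> vle (x * z) (y * t).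
Proof.
move=> xy zt; apply: vle_trans (vle_M2r z xy) _.
by rewrite ![y * _]mulrC; apply: vle_M2r.
Qed.

Lemma vle_lt_M x y z t : y != 0 -> vle x y -> vlt z t -> vlt (x * z) (y * t).
Proof.
move=> y0 xy zt; apply: (@vle_lt_trans (y * z)); first exact/vle_M2r.
by rewrite ![y * _]mulrC vlt_pM2r.
Qed.

Lemma vlt_sum (I : Type) (r : seq I) (P : pred I) (F : I -> K) z :
  z != 0 -> (forall i, P i -> vlt (F i) z) -> vlt (\sum_(i <- r | P i) F i) z.
Proof.
move=> z0 h; elim/big_rec: _ => [|i x Pi]; first by rewrite vlt0x.
exact/vltD/h.
Qed.

Lemma vle_max (I : finType) (i0 : I) (F : I -> K) :
  exists i, forall j, vle (F j) (F i).
Proof.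
suff [i hi] : exists i, forall j, j \in enum I -> vle (F j) (F i).
  by exists i => j; apply: hi; rewrite mem_enum.
elim: (enum I) => [|i s [k hk]]; first by exists i0.
case/orP: (vle_total (F i) (F k)) => ik.
  by exists k => j; rewrite inE => /orP[/eqP->|/hk].
exists i => j; rewrite inE => /orP[/eqP->|/hk h]; first exact: vle_refl.
exact: vle_trans h ik.
Qed.

Lemma vle_min (I : finType) (F : I -> K) :
  (forall i, F i != 0) -> exists2 d, d != 0 & forall j, vle d (F j).
Proof.
move=> F0; suff [d d0 hd] : exists2 d, d != 0 & forall j, j \in enum I -> vle d (F j).
  by exists d => // j; apply: hd; rewrite mem_enum.
elim: (enum I) => [|i s [d d0 hd]]; first by exists 1; rewrite ?oner_neq0.
case/orP: (vle_total d (F i)) => ik.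
  by exists d => // j; rewrite inE => /orP[/eqP->|/hd].
exists (F i) => // j; rewrite inE => /orP[/eqP->|/hd h]; first exact: vle_refl.
exact: vle_trans ik h.
Qed.

End NormOrder.

Lemma vext_vle (K L : valuedField) (e : vext K L) (x y : K) : vle (e x) (e y) = vle x y.
Proof.
have [->|x0] := eqVneq x 0; first by rewrite rmorph0 !vle0x.
have [->|y0] := eqVneq y 0; first by rewrite rmorph0 !vlex0 fmorph_eq0.
by rewrite !vleE ?fmorph_eq0 // !vext_val // vext_mono.
Qed.

(** * Maximal fields are spherically complete *)

Section ImmediateExtension.
Variables (K : valuedField) (E : fieldType) (iota : {rmorphism K -> E}).
Variable ev : (K -> Prop) -> Prop.
Hypothesis evI : forall P Q, ev P -> ev Q -> ev (fun x => P x /\ Q x).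
Hypothesis evS : forall P Q : K -> Prop, (forall x, P x -> Q x) -> ev P -> ev Q.
Hypothesis ev_ex : forall P, ev P -> exists x, P x.
Variable rho : E -> K -> K.
Hypothesis rho_approx :
  forall u, u != 0 -> exists c, ev (fun x => vlt (rho u x - c) (rho u x)).
Hypothesis rhoM : forall u u', u != 0 -> u' != 0 ->
  ev (fun x => vval (rho (u * u') x) = vval (rho u x * rho u' x)).
Hypothesis rhoD : forall u u', ev (fun x => rho (u + u') x = rho u x + rho u' x).
Hypothesis rhoC : forall c, ev (fun x => rho (iota c) x = c).

(** Here [ev] acts as a filter on K, and [rho u] follows u along it. An approximating constant [c]
    forces [rho u] to have eventually the value of [c], which becomes the value of u. *)
Lemma eventual_value : exists w : E -> vgroup K,
  forall u, u != 0 -> ev (fun x => rho u x != 0 /\ vval (rho u x) = w u).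
Proof.
suff /choice[w hw] : forall u, exists w,
    u != 0 -> ev (fun x => rho u x != 0 /\ vval (rho u x) = w) by exists w.
move=> u; have [->|u0] := eqVneq u 0; first by exists 0.
have [c hc] := rho_approx u0; exists (vval c) => _; apply: evS hc => x xc.
have x0 := vlt_neq0 xc; split=> //.
have c0 : c != 0 by apply: contraTneq xc => ->; rewrite subr0 vltxx.
by have [] := vlt_subr_eq xc; rewrite !vleE // => ? ?; apply/le_anti/andP.
Qed.

(** The eventual values turn E into a valued field extending K with the same value group, and
    approximating constants supply all residues. The extension is therefore immediate, and
    maximality applies. Multiplicativity of [rho] is asked for values only, since reduced
    representatives modulo a polynomial do not multiply exactly. *)
Lemma maximal_onto : maximal_valued K -> forall u, exists c, iota c = u.
Proof.
move=> maxK; have [w hw] := eventual_value.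
have wM x y : x != 0 -> y != 0 -> w (x * y) = w x + w y.
  move=> x0 y0; have xy0 := mulf_neq0 x0 y0.
  have /ev_ex[a [[[[_ <-] [xa <-]] [ya <-]] ->]] :=
    evI (evI (evI (hw _ xy0) (hw _ x0)) (hw _ y0)) (rhoM x0 y0).
  exact: vvalM.
have wD x y : x != 0 -> y != 0 -> x + y != 0 -> Order.min (w x) (w y) <= w (x + y).
  move=> x0 y0 xy0.
  have /ev_ex[a [[[[xya <-] [xa <-]] [ya <-]] Da]] :=
    evI (evI (evI (hw _ xy0) (hw _ x0)) (hw _ y0)) (rhoD x y).
  by rewrite Da vvalD // -Da.
have wC c : c != 0 -> w (iota c) = vval c.
  move=> c0; have ic0 : iota c != 0 by rewrite fmorph_eq0.
  by have /ev_ex[a [[_ <-] ->]] := evI (hw _ ic0) (rhoC c).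
have w_surj g : exists2 x, x != 0 & w x = g.
  have [c c0 <-] := vval_surj g.
  by exists (iota c); rewrite ?fmorph_eq0 ?wC.
pose EV := ValuedField wM wD w_surj.
pose e : vext K EV := @VExt K EV iota idfun (fun _ _ => erefl) wC.
suff imm : immediate e by exact: maxK imm.
split=> [h|r]; first by exists h.
have [[u uP] ->] := residueP r.
have [u0|u0] := eqVneq u 0.
  exists 0; rewrite rmorph0 -[0](rmorph0 (@res EV)); congr res.
  by apply: val_inj.
(* The constant has the value of u, so it is integral; u - c has greater value than u, so it lies in
   the maximal ideal. Hence [c] has the residue of u. *)
have [c hc] := rho_approx u0.
have [c0 wc] : c != 0 /\ vval c = w u.
  have /ev_ex[a [ac [a0 <-]]] := evI hc (hw _ u0).
  have c0 : c != 0 by apply: contraTneq ac => ->; rewrite subr0 vltxx.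
  by split=> //; have [] := vlt_subr_eq ac; rewrite !vleE // => ? ?; apply/le_anti/andP.
have cP : c \in @vring_pred K.
  by move: uP; rewrite /in_mem /= /vring_pred (negPf u0) (negPf c0) /= wc.
exists (res (VRing cP)); rewrite vext_resE; apply/eqP; rewrite resE.
rewrite /in_mem /= /vmax -[vring_val _]/(iota c - u).
have [//|d0 /=] := eqVneq (iota c - u) 0.
have uc0 : u - iota c != 0 by rewrite -opprB oppr_eq0.
rewrite [X in _ < X](_ : _ = w (u - iota c)); last by rewrite -opprB; exact: (@vvalN EV).
have /ev_ex[a [[[ac [a0 wu]] [b0 <-]] [Dab Da]]] :=
  evI (evI (evI hc (hw _ u0)) (hw _ uc0)) (evI (rhoD (u - iota c) (iota c)) (rhoC c)).
have {}Dab : rho u a - c = rho (u - iota c) a by rewrite -{1}[u](subrK (iota c)) Dab Da addrK.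
move: ac; rewrite Dab vltE // wu; apply: le_lt_trans.
by move: uP; rewrite /in_mem /= /vring_pred (negPf u0).
Qed.

End ImmediateExtension.

(** Balls are described without centre or radius: two points inside are closer to each other than to
    any point outside. This covers open and closed balls at once. *)
Record ball_chain (K : valuedField) (I : Type) (B : I -> K -> Prop) : Prop := BallChain {
  chain_nonempty : forall i, exists x, B i x;
  chain_total : forall i j,
    (forall x, B i x -> B j x) \/ (forall x, B j x -> B i x);
  chain_ball : forall i a b c, B i b -> B i c -> ~ B i a -> vlt (b - c) (b - a)
}.

Definition spherically_complete (K : valuedField) : Prop :=
  forall (I : Type) (B : I -> K -> Prop), ball_chain B -> exists x, forall i, B i x.

(** * Polynomials along a chain of balls with empty intersection *)

Section Kaplansky.
Variables (K : valuedField) (I : Type) (B : I -> K -> Prop).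
Hypotheses (ballB : ball_chain B) (emptyB : forall x, exists i, ~ B i x).

Definition eventually (P : K -> Prop) := exists i, forall x, B i x -> P x.

Lemma eventuallyI P Q :
  eventually P -> eventually Q -> eventually (fun x => P x /\ Q x).
Proof.
move=> [i hi] [j hj]; case: (chain_total ballB i j) => h.
  by exists i => x Bx; split; [apply: hi | apply/hj/h].
by exists j => x Bx; split; [apply/hi/h | apply: hj].
Qed.

Lemma eventuallyS (P Q : K -> Prop) :
  (forall x, P x -> Q x) -> eventually P -> eventually Q.
Proof. by move=> PQ [i hi]; exists i => x /hi/PQ. Qed.

Lemma eventually_ex P : eventually P -> exists x, P x.
Proof. by move=> [i hi]; have [x /hi] := chain_nonempty ballB i; exists x. Qed.

Lemma eventuallyT (P : K -> Prop) : (forall x, P x) -> eventually P.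
Proof. by move=> h; have [i _] := emptyB 0; exists i. Qed.

Lemma eventually_neq a : eventually (fun x => x != a).
Proof.
by have [i hi] := emptyB a; exists i => x Bx; apply: contra_notN hi => /eqP <-.
Qed.

(** The absolute value of g is a nonzero constant on some ball; one inequality suffices because x
    and y can be exchanged. *)
Definition stable (g : {poly K}) := exists i, forall x y, B i x -> B i y ->
  g.[x] != 0 /\ vle g.[x] g.[y].

Lemma stable_neq0 g : stable g -> eventually (fun x => g.[x] != 0).
Proof. by move=> [i hi]; exists i => x Bx; have [] := hi x x Bx Bx. Qed.

Lemma stableI g h : stable g -> stable h -> exists i, forall x y, B i x -> B i y ->
  [/\ g.[x] != 0, vle g.[x] g.[y], h.[x] != 0 & vle h.[x] h.[y]].
Proof.
move=> [i hi] [j hj]; case: (chain_total ballB i j) => s.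
  by exists i => x y Bx By; have [] := hi _ _ Bx By; have [] := hj _ _ (s _ Bx) (s _ By).
by exists j => x y Bx By; have [] := hj _ _ Bx By; have [] := hi _ _ (s _ Bx) (s _ By).
Qed.

Lemma stableM g h : stable g -> stable h -> stable (g * h).
Proof.
move=> sg sh; have [i hi] := stableI sg sh; exists i => x y Bx By.
have [g0 gxy h0 hxy] := hi x y Bx By.
by rewrite !hornerM mulf_neq0 // vle_M.
Qed.

Lemma stable_mulr q f : stable (q * f) -> stable q -> stable f.
Proof.
move=> sqf sq; have [i hi] := stableI sqf sq; exists i => x y Bx By.
have [+ + q0 _] := hi x y Bx By; have [_ _ q0y qyx] := hi y x By Bx.
rewrite !hornerM mulf_eq0 (negPf q0) /= => -> qf; split=> //.
rewrite -(vle_pM2r _ _ q0) ![_.[_] * q.[x]]mulrC; apply: vle_trans qf _.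
exact: vle_M2r.
Qed.

Lemma stableC c : c != 0 -> stable c%:P.
Proof.
move=> c0; have [i _] := emptyB 0.
by exists i => x y _ _; rewrite !hornerC vle_refl.
Qed.

(** On a ball where |g| and |h| are constant, |h| < |g| at one point gives |h| < |g| everywhere, so
    |g - h| = |g| is constant there and g - h is stable. *)
Lemma stable_subr g h : stable g -> stable h -> ~ stable (g - h) ->
  eventually (fun x => vle g.[x] h.[x]).
Proof.
move=> sg sh; have [i hi] := stableI sg sh; apply: contra_notP => nle.
exists i => x y Bx By.
have [z [Bz hgz]] : exists z, B i z /\ vlt h.[z] g.[z].
  apply: contrapT => nz; apply: nle; exists i => z Bz.
  by apply/negPn/negP => hg; apply: nz; exists z.
have cst t : B i t -> vle g.[t] (g - h).[t] /\ vle (g - h).[t] g.[t].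
  move=> Bt; have [_ _ _ htz] := hi t z Bt Bz; have [_ gzt _ _] := hi z t Bz Bt.
  have hg : vlt h.[t] g.[t] by apply: vle_lt_trans htz (vlt_le_trans hgz gzt).
  by rewrite !hornerE; apply: vlt_subr_eq; rewrite opprB addrC subrK.
have [gx0 gxy _ _] := hi x y Bx By.
have [gx xg] := cst x Bx; have [gy yg] := cst y By; split.
  by apply: contraNneq gx0 => fx; move: gx; rewrite fx vlex0.
exact: vle_trans xg (vle_trans gxy gy).
Qed.

Lemma stable_sub_val g h : stable g -> stable h -> ~ stable (g - h) ->
  eventually (fun x => vval g.[x] = vval h.[x]).
Proof.
move=> sg sh ns; have ns' : ~ stable (h - g).
  apply: contra_not ns => -[i hi]; exists i => x y Bx By.
  have [] := hi x y Bx By.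
  by rewrite -[g - h]opprB ![(- (h - g)).[_]]hornerN oppr_eq0 vleNx vlexN.
have := eventuallyI (eventuallyI (stable_subr sg sh ns) (stable_subr sh sg ns'))
  (eventuallyI (stable_neq0 sg) (stable_neq0 sh)).
apply: eventuallyS => x [[gh hg] [g0 h0]].
by move: gh hg; rewrite !vleE // => ? ?; apply/le_anti/andP.
Qed.

(* With g = q (X - a) + g(a) and a taken where |g| is already constant, replacing
   q by an approximating constant changes g by less than |q (X - a)| <= |g|, which
   reduces the claim to linear polynomials. *)
Lemma stable_approx n (g : {poly K}) :
  (forall h : {poly K}, h != 0 -> (size h <= n)%N -> stable h) ->
  g != 0 -> (size g <= n)%N ->
  exists c, eventually (fun x => vlt (g.[x] - c) g.[x]).
Proof.
move=> stab g0 gn; have [m] := ubnP (size g); elim: m g g0 gn => // m IH g g0 gn gm.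
have [i hi] := stab _ g0 gn.
have [a Ba] := chain_nonempty ballB i.
have : root (g - g.[a]%:P) a by rewrite rootE !hornerE subrr.
case/factor_theorem => q Dg; have {}Dg : g = q * ('X - a%:P) + g.[a]%:P.
  by rewrite -Dg subrK.
have [q0|q0] := eqVneq q 0.
  exists g.[a]; exists i => x Bx; rewrite Dg q0 !hornerE subrr vlt0x.
  by have [] := hi a a Ba Ba.
have qg : (size q < size g)%N.
  have sqX : size (q * ('X - a%:P)) = (size q).+1.
    by rewrite size_mul ?polyXsubC_eq0 // size_XsubC addn2.
  rewrite Dg size_polyDl sqX ?size_polyC //.
  by case: (_ != 0); rewrite // ltnS size_poly_gt0.
have [c' hc'] := IH _ q0 (leq_trans (ltnW qg) gn) (leq_trans qg gm).
have c'0 : c' != 0.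
  have [x xc] := eventually_ex hc'.
  by apply: contraTneq xc => ->; rewrite subr0 vltxx.
(* The zero of the linear polynomial c' (X - a) + g(a). Some ball misses it, and on that ball x - b
   is smaller than x - a', so x may be replaced by the fixed point b. *)
pose a' := a - g.[a] / c'.
have [j hj] := emptyB a'.
have [b Bb] := chain_nonempty ballB j.
exists (c' * (b - a')).
have hi' : eventually (fun x => vle g.[a] g.[x]).
  by exists i => x Bx; have [] := hi a x Ba Bx.
have hj' : eventually (fun x => vlt (x - b) (x - a')).
  by exists j => x Bx; apply: chain_ball ballB _ _ _ _ Bx Bb hj.
have := eventuallyI (eventuallyI hc' (eventually_neq a)) (eventuallyI hi' hj').
apply: eventuallyS => x [[xc xa] [gx xb]].
have xa0 : x - a != 0 by rewrite subr_eq0.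
have Dgx : g.[x] = q.[x] * (x - a) + g.[a] by rewrite {1}Dg !hornerE.
have hl : vlt (g.[x] - c' * (x - a')) g.[x].
  apply: (@vlt_le_trans _ (q.[x] * (x - a))).
    have -> : g.[x] - c' * (x - a') = (q.[x] - c') * (x - a).
      by rewrite Dgx /a'; field.
    by rewrite vlt_pM2r.
  have -> : q.[x] * (x - a) = g.[x] - g.[a] by rewrite Dgx addrK.
  by rewrite vleB ?vle_refl.
have [_ lg] := vlt_subr_eq hl.
have -> : g.[x] - c' * (b - a') = (g.[x] - c' * (x - a')) + c' * (x - b).
  by ring.
apply: vltD => //; apply: vlt_le_trans lg.
by rewrite ![c' * _]mulrC vlt_pM2r.
Qed.

End Kaplansky.

Lemma fraction_numden (R : idomainType) (u : {fraction R}) :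
  exists n d : R, d != 0 /\ u * @FracField.tofrac R d = @FracField.tofrac R n.
Proof.
elim/quotW: u => x; exists \n_x, \d_x; have d0 := denom_ratioP x; split=> //.
rewrite -[LHS]/(FracField.mul _ _) !piE; apply/eqP.
by rewrite FracField.equivf_def /FracField.mulf !numden_Ratio ?mulf_neq0 ?oner_neq0 // !mulr1 mulrC.
Qed.

(** * Immediate extensions built from a chain with empty intersection *)

Section KaplanskyContradiction.
Variables (K : valuedField) (I : Type) (B : I -> K -> Prop).
Hypotheses (maxK : maximal_valued K) (ballB : ball_chain B).
Hypothesis emptyB : forall x, exists i, ~ B i x.

Let ev := eventually B.

Lemma stableXsubC a : stable B ('X - a%:P).
Proof.
have [i hi] := emptyB a; exists i => x y Bx By; rewrite !hornerE.
have lt_xy := chain_ball ballB Bx By hi; split; first exact: vlt_neq0 lt_xy.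
by have [] := @vlt_subr_eq _ (x - a) (y - a); rewrite ?addrKA // opprB addrA subrK.
Qed.

(** If all nonzero polynomials were stable, evaluating fractions along the chain would make K(X) an
    immediate extension of K. Maximality would then turn X into a constant. *)
Lemma exists_unstable : exists2 f : {poly K}, f != 0 & ~ stable B f.
Proof.
apply: contrapT => nex.
have stab f : f != 0 -> stable B f.
  by move=> f0; apply: contrapT => nf; apply: nex; exists f.
pose tf : {poly K} -> {fraction {poly K}} := @FracField.tofrac _.
have tf_inj : injective tf by move=> p q /eqP; rewrite tofrac_eq => /eqP.
have /choice[nd hnd] (u : {fraction {poly K}}) :
    exists nd : {poly K} * {poly K}, nd.2 != 0 /\ u * tf nd.2 = tf nd.1.
  by have [n [d h]] := fraction_numden u; exists (n, d).
pose rho u x := (nd u).1.[x] / (nd u).2.[x].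
have den0 u : ev (fun x => (nd u).2.[x] != 0).
  by apply/stable_neq0/stab; have [] := hnd u.
pose iota : {rmorphism K -> {fraction {poly K}}} := (@FracField.tofrac _ \o polyC)%FUN.
have iotaE c : iota c = tf c%:P by [].
have rhoM u u' : ev (fun x => rho (u * u') x = rho u x * rho u' x).
  have := eventuallyI ballB (den0 (u * u')) (eventuallyI ballB (den0 u) (den0 u')).
  apply: eventuallyS => x [d0 [du du']]; rewrite /rho mulf_div.
  apply/eqP; rewrite eqr_div ?mulf_neq0 //; apply/eqP; rewrite -!hornerM.
  congr (_.[x]); apply: tf_inj; have [_ h] := hnd (u * u').
  rewrite /tf !tofracM -!/(tf _) -h; have [_ <-] := hnd u; have [_ <-] := hnd u'.
  by ring.
have rhoD u u' : ev (fun x => rho (u + u') x = rho u x + rho u' x).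
  have := eventuallyI ballB (den0 (u + u')) (eventuallyI ballB (den0 u) (den0 u')).
  apply: eventuallyS => x [d0 [du du']]; rewrite /rho addf_div //.
  apply/eqP; rewrite eqr_div ?mulf_neq0 //; apply/eqP; rewrite -!(hornerM, hornerD).
  congr (_.[x]); apply: tf_inj; have [_ h] := hnd (u + u').
  rewrite /tf !(tofracM, tofracD) -!/(tf _) -h; have [_ <-] := hnd u.
  by have [_ <-] := hnd u'; ring.
have rho_tf p : ev (fun x => rho (tf p) x = p.[x]).
  apply: eventuallyS (den0 (tf p)) => x d0; apply: (canLR (mulfK d0)).
  rewrite -hornerM; congr (_.[x]); apply: tf_inj; have [_ <-] := hnd (tf p).
  by rewrite /tf tofracM.
have rho_approx u : u != 0 -> exists c, ev (fun x => vlt (rho u x - c) (rho u x)).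
  have [d0 Du] := hnd u => u0.
  have n0 : (nd u).1 != 0.
    apply: contraNneq u0 => n0; move: Du; rewrite n0 [tf 0]tofrac0 => /eqP.
    by rewrite mulf_eq0 => /orP[//|]; rewrite (tofrac_eq0 (nd u).2) (negPf d0).
  have [a ha] := stable_approx ballB emptyB (fun h h0 _ => stab h h0) n0 (leqnn _).
  have [b hb] := stable_approx ballB emptyB (fun h h0 _ => stab h h0) d0 (leqnn _).
  exists (a / b); have := eventuallyI ballB (eventuallyI ballB ha hb) (den0 u).
  apply: eventuallyS => x [[xa xb] dx]; rewrite /rho.
  have nx := vlt_neq0 xa.
  have b0 : b != 0 by apply: contraTneq xb => ->; rewrite subr0 vltxx.
  rewrite -(vlt_pM2r _ _ (mulf_neq0 dx b0)).
  move: xa xb dx nx; set n := (nd u).1.[x]; set d := (nd u).2.[x] => xa xb dx nx.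
  (* After multiplication by d b the error of the quotient splits into the errors of numerator and
     denominator, each small compared with n b. *)
  have -> : (n / d - a / b) * (d * b) = (n - a) * d + n * (b - d).
    by field; rewrite dx b0.
  have -> : n / d * (d * b) = n * b by field.
  have [db bd] := vlt_subr_eq xb.
  have nbd : vle (n * d) (n * b) by rewrite ![n * _]mulrC vle_M2r.
  apply: vltD; apply: vlt_le_trans nbd; first by rewrite vlt_pM2r.
  by rewrite ![n * _]mulrC vlt_pM2r // vltBC.
have rho_val u u' : u != 0 -> u' != 0 ->
    ev (fun x => vval (rho (u * u') x) = vval (rho u x * rho u' x)).
  by move=> _ _; apply: eventuallyS (rhoM u u') => x ->.
have rhoC c : ev (fun x => rho (iota c) x = c).
  by apply: eventuallyS (rho_tf c%:P) => x ->; rewrite hornerC.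
have [a Da] := maximal_onto (eventuallyI ballB) (@eventuallyS _ _ B)
  (eventually_ex ballB) rho_approx rho_val rhoD rhoC maxK (tf 'X).
have /(congr1 (fun p : {poly K} => size p)) : a%:P = 'X by apply: tf_inj; rewrite -Da.
by rewrite size_polyX size_polyC; case: (_ != 0).
Qed.

(** An unstable f of least degree is irreducible, and evaluating representatives of lower degree
    along the chain makes K[X]/(f) an immediate extension of K. By maximality f has a root in K,
    hence is a product of two stable polynomials, which is absurd. *)
Lemma false_of_empty_chain : False.
Proof.
have [f0 f00 nf0] := exists_unstable.
pose P n := `[< exists f : {poly K}, [/\ f != 0, ~ stable B f & size f = n] >].
have exP : exists n, P n by exists (size f0); apply/asboolP; exists f0.
case: (ex_minnP exP) => n /asboolP[f [fn0 nf Dn]] minf.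
have stab (h : {poly K}) : h != 0 -> (size h <= n.-1)%N -> stable B h.
  move=> h0 hn; apply: contrapT => nh.
  have /minf : P (size h) by apply/asboolP; exists h.
  rewrite leqNgt => /negP; apply; apply: leq_ltn_trans hn _.
  by rewrite ltn_predL -Dn size_poly_gt0.
have n1 : (1 < size f)%N.
  rewrite ltnNge; apply/negP => /size1_polyC Df; apply: nf.
  by rewrite Df; apply: stableC emptyB _ _; rewrite -polyC_eq0 -Df.
(* In a proper factorization both factors have smaller degree, so they are stable, and so is their
   product. *)
have irr_f : irreducible_poly f.
  split=> // q q1 qf; have [r Df] := dvdpP _ _ qf.
  have q0 : q != 0 by apply: contraNneq fn0 => q0; rewrite Df q0 mulr0.
  have r0 : r != 0 by apply: contraNneq fn0 => r0; rewrite Df r0 mul0r.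
  rewrite -dvdp_size_eqp // eqn_leq dvdp_leq //= leqNgt; apply/negP => lt_qf.
  apply: nf; rewrite Df; apply: stableM => //; apply: stab => //.
    rewrite -ltnS prednK -?Dn ?size_poly_gt0 // Df size_mul //.
    have : (1 < size q)%N by rewrite ltn_neqAle eq_sym q1 size_poly_gt0.
    by case: (size q) => [|[|k]] // _; rewrite !addnS ltnS leq_addr.
  by rewrite -ltnS prednK -?Dn ?size_poly_gt0.
have [L dimL [z fz genz]] := irredp_FAdjoin irr_f.
pose iota : {rmorphism K -> L} := in_alg L.
pose ev_z (p : {poly K}) := (map_poly iota p).[z].
have ev_zM p q : ev_z (p * q) = ev_z p * ev_z q by rewrite /ev_z rmorphM hornerM.
have ev_zD p q : ev_z (p + q) = ev_z p + ev_z q by rewrite /ev_z rmorphD hornerD.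
have ev_zB p q : ev_z (p - q) = ev_z p - ev_z q.
  by rewrite /ev_z rmorphB hornerD hornerN.
have ev_root p : ev_z p = 0 -> f %| p.
  move/eqP; apply: contraLR; rewrite -irreducible_poly_coprime //.
  by rewrite -(coprimep_map iota) => /coprimep_root; apply.
have lt_nf (g : {poly K}) : (size g <= n.-1)%N = (size g < size f)%N.
  by rewrite -ltnS prednK ?Dn // -Dn size_poly_gt0.
have ev_inj (g h : {poly K}) : (size g <= n.-1)%N -> (size h <= n.-1)%N ->
    ev_z g = ev_z h -> g = h.
  rewrite !lt_nf => gn hn Egh; apply/eqP; rewrite -subr_eq0; apply/negPn/negP => gh0.
  have : f %| g - h by apply: ev_root; rewrite ev_zB Egh subrr.
  move/(dvdp_leq gh0); rewrite leqNgt => /negP; apply.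
  by apply: leq_ltn_trans (size_polyD _ _) _; rewrite size_polyN gtn_max gn hn.
(* [G u] is the unique representative of u of degree less than that of f. *)
have /choice[G hG] (u : L) : exists g : {poly K}, (size g <= n.-1)%N /\ ev_z g = u.
  have /Fadjoin1_polyP[p ->] : u \in <<1; z>>%VS by rewrite genz memvf.
  exists (p %% f); rewrite lt_nf ltn_modp fn0; split=> //.
  rewrite {2}(divp_eq p f) -/iota -[RHS]/(ev_z _) ev_zD ev_zM.
  by rewrite [ev_z f](eqP fz) mulr0 add0r.
have Gn u : (size (G u) <= n.-1)%N by have [] := hG u.
have GK u : ev_z (G u) = u by have [] := hG u.
have G0 u : u != 0 -> G u != 0.
  by apply: contraNneq => Gu; rewrite -[u]GK Gu /ev_z rmorph0 horner0.
have stabG u : u != 0 -> stable B (G u) by move=> u0; apply: stab; rewrite ?G0.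
have G_iota c : G (iota c) = c%:P.
  apply: ev_inj; rewrite ?GK //; last by rewrite /ev_z map_polyC hornerC.
  by rewrite lt_nf (leq_ltn_trans (size_polyC_leq1 c)).
have GD u v : G (u + v) = G u + G v.
  apply: ev_inj; rewrite ?ev_zD ?GK //.
  by apply: leq_trans (size_polyD _ _) _; rewrite geq_max !Gn.
have rho_approx u : u != 0 -> exists c, ev (fun x => vlt ((G u).[x] - c) (G u).[x]).
  by move=> u0; apply: stable_approx stab (G0 _ u0) (Gn u).
have rho_val u v : u != 0 -> v != 0 ->
    ev (fun x => vval (G (u * v)).[x] = vval ((G u).[x] * (G v).[x])).
  move=> u0 v0; have uv0 := mulf_neq0 u0 v0.
  have : f %| G (u * v) - G u * G v by apply: ev_root; rewrite ev_zB ev_zM !GK subrr.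
  case/dvdpP => q Dq.
  (* The difference is q f with q of smaller degree than f. If it were stable, then q would be
     nonzero and stable, and dividing by q would make f stable. Instability of the difference forces
     the two values to agree. *)
  have suvB : ~ stable B (G (u * v) - G u * G v).
    rewrite Dq => sqf; have qf0 : q * f != 0.
      by have [x] := eventually_ex ballB (stable_neq0 sqf); apply: contraNneq => ->;
        rewrite horner0.
    have q0 : q != 0 by apply: contraNneq qf0 => ->; rewrite mul0r.
    apply: nf; apply: (stable_mulr ballB sqf); apply: stab => //.
    have : (size (q * f)%R <= maxn (size f) (size (G u) + size (G v)).-1)%N.
      rewrite -Dq; apply: leq_trans (size_polyD _ _) _; rewrite size_polyN geq_max !leq_max.
      by rewrite size_polyMleq orbT ltnW // -lt_nf.
    rewrite size_mul // => hq; have := Gn u; have := Gn v; rewrite !lt_nf Dn => hv hu.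
    move: hq n1 hu hv; rewrite Dn /=.
    move: (size q) (size (G u)) (size (G v)) => k a b ? ? ? ?; lia.
  apply: eventuallyS (stable_sub_val ballB (stabG _ uv0) (stableM ballB _ _) suvB).
  - by move=> x ->; rewrite hornerM.
  - exact: stabG.
  - exact: stabG.
have rhoD u v : ev (fun x => (G (u + v)).[x] = (G u).[x] + (G v).[x]).
  by apply: (eventuallyT emptyB) => x; rewrite GD hornerD.
have rhoC c : ev (fun x => (G (iota c)).[x] = c).
  by apply: (eventuallyT emptyB) => x; rewrite G_iota hornerC.
have [a Da] := maximal_onto (eventuallyI ballB) (@eventuallyS _ _ B)
  (eventually_ex ballB) rho_approx rho_val rhoD rhoC maxK z.
have /factor_theorem[q Df] : root f a.
  by move: fz; rewrite -Da -/iota rootE horner_map fmorph_eq0.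
have q0 : q != 0 by apply: contraNneq fn0 => q0; rewrite Df q0 mul0r.
apply: nf; rewrite Df; apply: (stableM ballB); last exact: stableXsubC.
by apply: stab; rewrite // lt_nf Df size_mul ?polyXsubC_eq0 // size_XsubC addn2 ltnSn.
Qed.

End KaplanskyContradiction.

Theorem maximal_spherically_complete (K : valuedField) :
  maximal_valued K -> spherically_complete K.
Proof.
move=> maxK I B ballB; apply: contrapT => nB.
apply: (false_of_empty_chain maxK ballB) => x.
by apply: contrapT => nx; apply: nB; exists x => i; apply: contrapT => nBx; apply: nx; exists i.
Qed.

(** * Best approximation in finite dimensional subspaces *)

Section BestApproximation.
Variables (K E : valuedField) (f : {rmorphism K -> E}).
Hypothesis f_vle : forall x y, vle (f x) (f y) = vle x y.
Hypothesis sphK : spherically_complete K.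

(** Recursion on the list lets best approximations be built one vector at a time. *)
Fixpoint in_span (s : seq E) (y : E) : Prop :=
  if s is e :: s' then exists c : K, in_span s' (y - f c * e) else y = 0.

Lemma in_span0 s : in_span s 0.
Proof. by elim: s => //= e s IH; exists 0; rewrite rmorph0 mul0r subr0. Qed.

Lemma in_spanD s y z : in_span s y -> in_span s z -> in_span s (y + z).
Proof.
elim: s y z => [|e s IH] y z /=; first by move=> -> ->; rewrite addr0.
move=> [c hc] [d hd]; exists (c + d).
by rewrite (_ : _ - _ = (y - f c * e) + (z - f d * e)); [apply: IH | rewrite rmorphD; ring].
Qed.

Lemma in_spanZ s c y : in_span s y -> in_span s (f c * y).
Proof.
elim: s y => [|e s IH] y /=; first by move=> ->; rewrite mulr0.
by move=> [d /IH hd]; exists (c * d); rewrite rmorphM -mulrA -mulrBr.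
Qed.

Lemma in_spanN s y : in_span s y -> in_span s (- y).
Proof. by move/(in_spanZ (-1)); rewrite rmorphN1 mulN1r. Qed.

Lemma in_spanB s y z : in_span s y -> in_span s z -> in_span s (y - z).
Proof. by move=> ys /in_spanN; apply: in_spanD. Qed.

Lemma in_span_sum (I : Type) (r : seq I) (e : I -> E) (c : I -> K) :
  in_span [seq e i | i <- r] (\sum_(i <- r) f (c i) * e i).
Proof.
elim: r => [|i r IH] /=; first by rewrite big_nil.
by exists (c i); rewrite big_cons addrC addKr.
Qed.

Lemma in_span_mem s y : y \in s -> in_span s y.
Proof.
elim: s => //= e s IH; rewrite inE => /orP[/eqP->|/IH ys].
  by exists 1; rewrite rmorph1 mul1r subrr; apply: in_span0.
by exists 0; rewrite rmorph0 mul0r subr0.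
Qed.

Lemma in_span_coord s y : in_span s y ->
  exists c : nat -> K, y = \sum_(i < size s) f (c i) * s`_i.
Proof.
elim: s y => [|e s IH] y /=; first by move=> ->; exists (fun=> 0); rewrite big_ord0.
move=> [c0 /IH[c Dy]]; exists (fun i => if i is j.+1 then c j else c0).
by rewrite big_ord_recl /= -Dy addrC subrK.
Qed.

(** Replace e by its remainder e0 modulo the span of s. For each coefficient b let r b be the best
    remainder of y - b e0 modulo that span. The coefficients at distance at most |r b| / |e0| from b
    form a ball; these balls form a chain, and a common point is an optimal coefficient. *)
Lemma best_approx s y :
  exists2 w, in_span s w & forall w', in_span s w' -> vle (y - w) (y - w').
Proof.
elim: s y => [|e s IH] y /=.
  by exists 0 => // w' ->; apply: vle_refl.
have [we we_s we_best] := IH e; pose e0 := e - we.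
(* Since e0 is a shortest vector of e + span s, adding an element of the span to a multiple of e0
   cannot shorten it. *)
have De0 b w : in_span s w -> vle (f b * e0) (f b * e0 + w).
  move=> ws; have [->|b0] := eqVneq b 0; first by rewrite rmorph0 mul0r vle0x.
  have fb0 : f b != 0 by rewrite fmorph_eq0.
  have -> : f b * e0 + w = (e - (we - f b^-1 * w)) * f b.
    by rewrite fmorphV /e0; field.
  by rewrite mulrC vle_pM2r //; apply/we_best/in_spanB => //; apply: in_spanZ.
have /choice[w hw] (b : K) : exists w, in_span s w /\
    forall w', in_span s w' -> vle (y - f b * e0 - w) (y - f b * e0 - w').
  by have [w ws wb] := IH (y - f b * e0); exists w.
pose r b := y - f b * e0 - w b.
have ws b : in_span s (w b) by have [] := hw b.
have close b c : vle (r b) (r c) -> vle (f (b - c) * e0) (r c).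
  move=> rbc; apply: vle_trans (De0 _ _ (in_spanB (ws b) (ws c))) _.
  have -> : f (b - c) * e0 + (w b - w c) = r c - r b by rewrite /r rmorphB; ring.
  by rewrite vleB ?vle_refl.
pose B b c := vle (f (c - b) * e0) (r b).
have ballB : ball_chain B.
  split=> [b|b c|b a c d Bc Bd /negP Ba].
  - by exists b; rewrite /B subrr rmorph0 mul0r vle0x.
  - have sub b' c' : vle (r b') (r c') -> forall x, B b' x -> B c' x.
      move=> rbc x Bx; rewrite /B -(subrKA b') rmorphD mulrDl.
      by apply: vleD (close _ _ rbc); apply: vle_trans Bx rbc.
    by case/orP: (vle_total (r b) (r c)) => /sub; [left | right].
  - have e00 : e0 != 0 by apply: contraNneq Ba => z0; rewrite /B z0 mulr0 vle0x.
    have lt_r x : B b x -> vlt (f (x - b)) (f (a - b)).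
      by move=> Bx; rewrite -(vlt_pM2r _ _ e00); apply: vle_lt_trans Bx Ba.
    rewrite /vlt -f_vle -/(vlt _ _) (_ : c - d = (c - b) - (d - b)); last by ring.
    have cab : vlt (f (c - b)) (f (a - b)) := lt_r _ Bc.
    rewrite rmorphB; apply: (@vlt_le_trans _ (f (a - b))); first exact: vltB (lt_r _ Bd).
    have /vlt_subr_eq[] : vlt (f (a - b) - f (a - c)) (f (a - b)).
      by rewrite -rmorphB (_ : _ - _ = c - b) //; ring.
    by rewrite -[vle _ (f (a - c))]vlexN -rmorphN opprB.
have [b hb] := sphK ballB.
exists (f b * e0 + w b).
  exists b; rewrite (_ : _ - _ = w b - f b * we); last by rewrite /e0; ring.
  by apply: in_spanB => //; apply: in_spanZ.
move=> w' [c hc]; pose w1 := w' - f c * e0.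
have w1s : in_span s w1.
  rewrite (_ : w1 = (w' - f c * e) + f c * we); last by rewrite /w1 /e0; ring.
  by apply: in_spanD => //; apply: in_spanZ.
have rc : vle (r c) (y - w').
  rewrite (_ : y - w' = y - f c * e0 - w1); last by rewrite /w1; ring.
  by have [_] := hw c; apply.
apply: vle_trans rc; rewrite (_ : y - _ = r b); last by rewrite /r opprD addrA.
have [_ /(_ _ (ws c)) rb] := hw b; apply: vle_trans rb _.
rewrite (_ : _ - _ = r c - f (b - c) * e0); last by rewrite /r rmorphB; ring.
by apply: vleB; [apply: vle_refl | apply: hb].
Qed.

End BestApproximation.

(** * Finite residue and value extensions *)

Lemma res_vle (K : valuedField) (a b : vring K) :
  res a = res b -> vlt (vring_val a - vring_val b) 1.
Proof.
move/eqP; rewrite resE /in_mem /= /vmax -[vring_val (a - b)]/(vring_val a - vring_val b).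
have [->|d0 /=] := eqVneq (_ - _) 0; first by rewrite vlt0x oner_neq0.
by rewrite vltE ?oner_neq0 // vval1.
Qed.

Lemma val_sum_vring (K : valuedField) (I : Type) (r : seq I) (F : I -> vring K) :
  vring_val (\sum_(i <- r) F i) = \sum_(i <- r) vring_val (F i).
Proof. by elim/big_rec2: _ => // i x y _ <-. Qed.

Section FiniteCase.
Variables (K L : valuedField) (e : vext K L).
Hypothesis sphK : spherically_complete K.

(* If u_i lift a basis of Lv over Kv and the values of z_q represent vL/vK, then
   every nonzero y' in L is approximated by some sum c_i u_i z_q; hence the best
   approximation of y in the span of the u_i z_q is y itself. *)
Lemma finite_invariants_span :
  finite_ext (vext_res e) -> finite_group (vext_quot e) ->
  exists s : seq L, forall y, in_span e s y.
Proof.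
move=> [n [b hb]] [cls hcls].
have /choice[z hz] (g : vgroup L) : exists x : L, x != 0 /\ vval x = g.
  by have [x] := vval_surj g; exists x.
pose u i : vring L := repr (b i).
have res_u i : res (u i) = b i by rewrite /res reprK.
pose F (p : 'I_n * vext_quot e) := vring_val (u p.1) * z (repr p.2).
pose r := [seq (i, q) | q <- cls, i <- enum 'I_n].
exists [seq F p | p <- r] => y.
have [w ws wbest] := best_approx (vext_vle e) sphK [seq F p | p <- r] y.
have [/eqP|y0] := eqVneq (y - w) 0; first by rewrite subr_eq0 => /eqP->.
pose q : vext_quot e := \pi_(vext_quot e)%qT (vval (y - w)).
have : vval (y - w) - repr q \in @vext_group_range _ _ e.
  by rewrite Quotient.idealrBE reprK.
case/asboolP => h Dh; have [c c0 vc] := vval_surj h.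
have [z0 vz] := hz (repr q); set zq := z (repr q) in z0 vz.
have ec0 : e c != 0 by rewrite fmorph_eq0.
(* Here z_q represents the class of the value of y - w modulo vK and c in K corrects the difference,
   so t has value 0 and its residue can be expanded in the basis. *)
pose t := (y - w) / (e c * zq).
have t0 : t != 0 by rewrite mulf_neq0 ?invr_neq0 ?mulf_neq0.
have vt : vval t = 0.
  rewrite vvalM ?invr_neq0 ?mulf_neq0 // vvalV ?mulf_neq0 // vvalM // vext_val //.
  by rewrite vc vz -Dh subrK subrr.
have tP : t \in @vring_pred L by rewrite /in_mem /= /vring_pred vt lexx orbT.
have [a Da] := hb (res (VRing tP)).
pose v : vring L := \sum_i vext_int e (repr (a i)) * u i.
have : res (VRing tP) = res v.
  rewrite Da rmorph_sum; apply: eq_bigr => i _.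
  by rewrite rmorphM /= res_u -vext_resE; congr (vext_res e _ * _); rewrite /res reprK.
move/res_vle => /= lt1.
pose w1 := \sum_(i <- enum 'I_n) e (c * vring_val (repr (a i))) * F (i, q).
have Dw1 : vring_val v * (e c * zq) = w1.
  rewrite /v val_sum_vring mulr_suml /w1 big_enum /=; apply: eq_bigr => i _.
  by rewrite /F /= rmorphM -/zq; ring.
have w1s : in_span e [seq F p | p <- r] w1.
  apply: (big_ind (in_span e _)) => [|x x'|i _]; [exact: in_span0 | exact: in_spanD |].
  apply/in_spanZ/in_span_mem/map_f.
  by apply/allpairsPdep; exists q, i; split; rewrite ?hcls ?mem_enum.
(* The lifted expansion w1 cancels the leading part of y - w, so w + w1 is strictly closer to y than
   w, contradicting optimality. *)
have : vle (y - w) (y - (w + w1)) by apply/wbest/in_spanD.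
rewrite (_ : y - (w + w1) = (t - vring_val v) * (e c * zq)); last first.
  by rewrite mulrBl Dw1 /t divfK ?mulf_neq0 // opprD addrA.
rewrite (_ : y - w = t * (e c * zq)); last by rewrite /t divfK ?mulf_neq0.
rewrite vle_pM2r ?mulf_neq0 // => le_t.
have /vlt_le_trans /(_ le_t) : vlt (t - vring_val v) t.
  by apply: vlt_le_trans lt1 _; rewrite vleE ?oner_neq0 // vval1 vt lexx.
by rewrite vltxx.
Qed.

End FiniteCase.

(** The coordinates of 1, x, ..., x^n form a matrix with n + 1 rows and n columns; a nonzero vector
    of its left kernel gives the coefficients of a polynomial vanishing at x. *)
Lemma span_algebraic (F E : fieldType) (f : {rmorphism F -> E}) n (b : 'I_n -> E) :
  (forall x, exists c : 'I_n -> F, x = \sum_i f (c i) * b i) ->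
  forall x, algebraicOver f x.
Proof.
move=> span x; have /choice[c hc] (k : 'I_n.+1) := span (x ^+ k).
pose A := \matrix_(k < n.+1, i < n) c k i.
have /rowV0Pn[v vA v0] : kermx A != 0.
  rewrite -mxrank_eq0 mxrank_ker -lt0n subn_gt0 ltnS.
  exact: leq_trans (rank_leq_col A) _.
have {vA} vA0 : v *m A = 0 by apply/sub_kermxP.
exists (rVpoly v).
  by apply: contraNneq v0 => p0; rewrite -[v]rVpolyK p0 linear0.
rewrite rootE (@horner_coef_wide _ n.+1); last first.
  by rewrite size_map_poly size_poly.
apply/eqP; transitivity (\sum_(i < n) f ((v *m A) 0 i) * b i); last first.
  by rewrite vA0 big1 // => i _; rewrite mxE rmorph0 mul0r.
under [RHS]eq_bigr do rewrite mxE rmorph_sum mulr_suml.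
rewrite exchange_big; apply: eq_bigr => k _.
rewrite coef_map coef_rVpoly_ord hc mulr_sumr; apply: eq_bigr => i _.
by rewrite mxE rmorphM mulrA.
Qed.

Lemma transcendental_infinite (K L : valuedField) (e : vext K L) :
  maximal_valued K -> transcendental_ext e ->
  ~ finite_ext (vext_res e) \/ ~ finite_group (vext_quot e).
Proof.
move=> maxK tr; apply/not_andP => -[finR finV]; apply: tr.
have [s hs] := finite_invariants_span (maximal_spherically_complete maxK) finR finV.
apply: (@span_algebraic _ _ _ (size s) (fun i => s`_i)) => x.
by have [c ->] := in_span_coord (hs x); exists (fun i => c i).
Qed.

(** * Small elements of the base field *)

Section Cofinality.
Variables (K L : valuedField) (e : vext K L).
Hypothesis torsion : torsion_group (vext_quot e).

Lemma torsion_value (g : vgroup L) : exists n h, (0 < n)%N /\ g *+ n = vext_group e h.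
Proof.
have [n [n0 ng _]] := torsion (\pi_(vext_quot e)%qT g).
have pi_mulrn k : \pi_(vext_quot e)%qT (g *+ k) = \pi_(vext_quot e)%qT g *+ k.
  elim: k => [|k IH]; first by rewrite !mulr0n piE.
  by rewrite !mulrS -IH piE.
have : g *+ n - 0 \in @vext_group_range _ _ e.
  by rewrite Quotient.idealrBE pi_mulrn ng; apply/eqP/esym/(pi_mulrn 0%N).
by rewrite subr0 => /asboolP[h Dh]; exists n, h.
Qed.

Lemma oag_le_mulrn (G : oagType) (g : G) n : 0 <= g -> (0 < n)%N -> g <= g *+ n.
Proof.
move=> g0; case: n => // n _; rewrite mulrS -{1}[g]addr0 oag_le2D.
by elim: n => // n IH; rewrite mulrS -[0]addr0 oag_leD.
Qed.

Hypothesis alg_res : forall u : residue L, algebraicOver (vext_res e) u.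
Hypothesis tr : transcendental_ext e.

(** If v were trivial on K, torsion would make it trivial on L. Residue fields would then be the
    fields themselves, and algebraicity of Lv|Kv would pass to L|K. *)
Lemma nontrivial_value : exists h : vgroup K, 0 < h.
Proof.
apply: contrapT => triv; apply: tr => y.
have trivK (h : vgroup K) : h = 0.
  have le0 (k : vgroup K) : k <= 0.
    by rewrite -[_ <= _]negbK -oag_ltNge; apply/negP => k0; apply: triv; exists k.
  apply/le_anti; rewrite le0 /=.
  by have := oag_leD2l h _ _ (le0 (- h)); rewrite subrr addr0.
have trivL (g : vgroup L) : g = 0.
  have le0 (k : vgroup L) : k <= 0.
    rewrite -[_ <= _]negbK -oag_ltNge; apply/negP => k0.
    have [n [h [n0 Dh]]] := torsion_value k.
    have := oag_le_mulrn (ltW k0) n0; rewrite Dh (trivK h) raddf0.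
    by move/(lt_le_trans k0); rewrite ltxx.
  apply/le_anti; rewrite le0 /=.
  by have := oag_leD2l g _ _ (le0 (- g)); rewrite subrr addr0.
have yP : y \in @vring_pred L by rewrite /in_mem /= /vring_pred (trivL (vval y)) lexx orbT.
pose Y := VRing yP; have [p p0 py] := alg_res (res Y).
(* Coefficients are lifted through chosen representatives; a nonzero residue has a nonzero
   representative, so P is nonzero. *)
pose P := \poly_(i < size p) vring_val (repr p`_i).
exists P.
  apply: contraNneq p0 => P0; apply/eqP/polyP => i; rewrite coef0.
  have [ip|pi] := ltnP i (size p); last exact: nth_default.
  have /(congr1 (fun q : {poly K} => q`_i)) := P0; rewrite coef_poly ip coef0 => r0.
  rewrite -[LHS]reprK -/(res _) (_ : repr _ = 0) ?rmorph0 //.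
  exact: val_inj.
pose Q : vring L := \sum_(i < size p) vext_int e (repr p`_i) * Y ^+ i.
have res_Q : res Q = 0.
  rewrite /Q rmorph_sum /= -[RHS](eqP py) (@horner_coef_wide _ (size p)); last first.
    by rewrite size_map_poly.
  apply: eq_bigr => i _; rewrite rmorphM rmorphXn /= -vext_resE coef_map.
  by congr (vext_res e _ * _); rewrite /res reprK.
have XE k : vring_val (Y ^+ k) = y ^+ k.
  by elim: k => // k IH; rewrite !exprS -IH.
have DQ : (map_poly e P).[y] = vring_val Q.
  rewrite (@horner_coef_wide _ (size p)); last by rewrite size_map_poly size_poly.
  rewrite val_sum_vring; apply: eq_bigr => i _.
  by rewrite coef_map coef_poly ltn_ord /= XE.
(* With a trivial valuation the maximal ideal is 0, so an element with residue 0 vanishes. *)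
rewrite rootE DQ; have /eqP : res Q = res 0 by rewrite res_Q rmorph0.
by rewrite resE subr0 /in_mem /= /vmax (trivL (vval _)) ltxx orbF.
Qed.

(** Torsion makes vK cofinal in vL: a positive value is at most any positive multiple of itself, and
    some such multiple lies in vK. Adding a positive h makes the inequality strict. *)
Lemma exists_smaller (d : L) : d != 0 -> exists2 c : K, c != 0 & vlt (e c) d.
Proof.
move=> d0; have [h h0] := nontrivial_value.
suff [k lt_k] : exists k, vval d < vext_group e k.
  by have [c c0 vc] := vval_surj k; exists c; rewrite // vltE ?fmorph_eq0 // vext_val // vc.
have eh0 : 0 < vext_group e h by rewrite -(raddf0 (vext_group e)) (leW_mono (@vext_mono _ _ e)).
have [le0|gt0] := comparable_leP (oag_comparable (vval d) 0).
  by exists h; apply: le_lt_trans le0 eh0.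
have [n [k [n0 Dk]]] := torsion_value (vval d).
exists (k + h); apply: le_lt_trans (oag_le_mulrn (ltW gt0) n0) _.
by rewrite Dk raddfD /= oag_ltNge -[X in _ <= X]addr0 oag_le2D -oag_ltNge.
Qed.

End Cofinality.

(** * Openness of linear independence *)

Lemma vle_min2 (K : valuedField) (x y : K) : x != 0 -> y != 0 ->
  exists2 z, z != 0 & vle z x /\ vle z y.
Proof.
move=> x0 y0; case/orP: (vle_total x y) => h; first by exists x; rewrite ?vle_refl.
by exists y; rewrite ?vle_refl.
Qed.

Lemma horner_continuous (E : valuedField) (p : {poly E}) (s d : E) : d != 0 ->
  exists2 r, r != 0 & forall x, vlt (x - s) r -> vlt (p.[x] - p.[s]) d.
Proof.
elim/poly_ind: p d => [|p c IH] d d0.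
  by exists 1 => [|x _]; rewrite ?oner_neq0 // !horner0 subrr vlt0x.
have [m m0 [m1 ms]] : exists2 m, m != 0 & vle 1 m /\ vle s m.
  case/orP: (vle_total s 1) => h; first by exists 1; rewrite ?oner_neq0 ?vle_refl.
  exists s; rewrite ?vle_refl //.
  by apply: contraTneq h => ->; rewrite vlex0 oner_eq0.
have [r1 r10 h1] := IH (d / m) (mulf_neq0 d0 (invr_neq0 m0)).
have [r2 r20 h2] : exists2 r2, r2 != 0 & forall y, vlt y r2 -> vlt (p.[s] * y) d.
  have [->|ps0] := eqVneq p.[s] 0.
    by exists 1 => [|y _]; rewrite ?oner_neq0 // mul0r vlt0x.
  exists (d / p.[s]) => [|y yd]; first by rewrite mulf_neq0 ?invr_neq0.
  by rewrite -(divfK ps0 d) mulrC vlt_pM2r.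
have [r3 r30 [r31 r32]] := vle_min2 r10 r20.
have [r r0 [rr1 rr3]] := vle_min2 (oner_neq0 E) r30.
exists r => // x xr; rewrite !hornerMXaddC.
rewrite (_ : _ - _ = (p.[x] - p.[s]) * x + p.[s] * (x - s)); last by ring.
apply: vltD; last by apply/h2/(vlt_le_trans xr)/(vle_trans rr3).
have xm : vle x m.
  rewrite -(subrK s x); apply: vleD ms; apply: vle_trans (vltW xr) _.
  exact: vle_trans rr1 m1.
have px : vlt (p.[x] - p.[s]) (d / m) by apply/h1/(vlt_le_trans xr)/(vle_trans rr3).
apply: (@vle_lt_trans _ ((p.[x] - p.[s]) * m)).
  by rewrite ![_ * x]mulrC ![_ * m]mulrC; apply: vle_M2r.
by rewrite -[X in vlt _ X](divfK m0 d) vlt_pM2r.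
Qed.

Section OpenIndependence.
Variables (K E : valuedField) (f : {rmorphism K -> E}).
Hypothesis f_vle : forall x y, vle (f x) (f y) = vle x y.
Hypothesis sphK : spherically_complete K.

Definition lin_indep (I : finType) (v : I -> E) :=
  forall c : I -> K, \sum_i f (c i) * v i = 0 -> forall i, c i = 0.

Lemma in_span_image (I : finType) (v : I -> E) (r : seq I) y :
  in_span f [seq v i | i <- r] y ->
  exists c : I -> K, (forall i, i \notin r -> c i = 0) /\ y = \sum_i f (c i) * v i.
Proof.
elim: r y => [|j r IH] y /=.
  by move=> ->; exists (fun=> 0); split=> //; rewrite big1 // => i _; rewrite rmorph0 mul0r.
move=> [c0 /IH[c [cr Dy]]].
exists (fun i => c i + (if i == j then c0 else 0)); split=> [i|].
  by rewrite inE negb_or => /andP[/negPf-> /cr->]; rewrite addr0.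
under eq_bigr do rewrite rmorphD mulrDl.
rewrite big_split /= -Dy (bigD1 j) //= eqxx big1 => [|i /negPf->].
  by rewrite addr0 subrK.
by rewrite rmorph0 mul0r.
Qed.

(* Each vector of an independent family has positive distance from the span of the
   others, because that distance is attained. *)
Lemma lin_indep_open (I : finType) (p : I -> {poly E}) (s : E) :
  lin_indep (fun i => (p i).[s]) ->
  exists2 r, r != 0 & forall x, vlt (x - s) r -> lin_indep (fun i => (p i).[x]).
Proof.
move=> indep; pose others i := [seq (p j).[s] | j <- enum (predC1 i)].
have /choice[w hw] i : exists w, in_span f (others i) w /\
    forall w', in_span f (others i) w' -> vle ((p i).[s] - w) ((p i).[s] - w').
  by have [w] := best_approx f_vle sphK (others i) (p i).[s]; exists w.
have D0 i : (p i).[s] - w i != 0.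
  have [ws _] := hw i; rewrite subr_eq0; apply/eqP => Dw.
  have [c [ci Dc]] := in_span_image ws.
  have {}ci : c i = 0 by apply: ci; rewrite mem_enum !inE eqxx.
  (* If the distance were 0, expressing the i-th vector through the others would give a relation
     with coefficient -1 at i. *)
  have : c i - 1 = 0; last by rewrite ci sub0r => /eqP; rewrite oppr_eq0 oner_eq0.
  rewrite -[1]/(if true then 1 else 0 : K) -(eqxx i).
  apply: (indep (fun j => c j - (if j == i then 1 else 0))).
  under eq_bigr do rewrite rmorphB mulrBl.
  rewrite big_split /= -Dc -Dw sumrN (bigD1 i) //= eqxx rmorph1 mul1r big1 ?addr0 ?subrr //.
  by move=> j /negPf->; rewrite rmorph0 mul0r.
have [d d0 hd] := vle_min D0.
have /choice[r hr] i : exists r, r != 0 /\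
    forall x, vlt (x - s) r -> vlt ((p i).[x] - (p i).[s]) d.
  by have [r] := horner_continuous (p i) s d0; exists r.
have [r0 r00 hr0] := vle_min (fun i => (hr i).1).
exists r0 => // x xr c sum0 i0; apply/eqP/negPn/negP => ci0.
(* Dividing the relation by a coefficient of greatest absolute value makes coefficient i equal to 1
   and all others at most 1 in absolute value. *)
have [i imax] := vle_max i0 c.
have c0 : c i != 0.
  by apply: contraNneq ci0 => ci; rewrite -vlex0 -ci imax.
pose a j := c j / c i.
have sum_a : \sum_j f (a j) * (p j).[x] = 0.
  rewrite -[RHS](mulr0 (f (c i)^-1)) -[in RHS]sum0 mulr_sumr; apply: eq_bigr => j _.
  by rewrite /a rmorphM; ring.
pose w' := - \sum_(j <- enum (predC1 i)) f (a j) * (p j).[s].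
have w's : in_span f (others i) w' by apply/in_spanN/in_span_sum.
have [_ /(_ _ w's)] := hw i; apply/negP; rewrite -/(vlt _ _).
apply: vlt_le_trans (hd i).
(* Subtracting the relation at x leaves only the small differences p_j(s) - p_j(x), so w' would be
   closer to p_i(s) than [d] permits. *)
have -> : (p i).[s] - w' = \sum_j f (a j) * ((p j).[s] - (p j).[x]).
  under [RHS]eq_bigr do rewrite mulrBr.
  rewrite big_split /= sumrN sum_a subr0 (bigD1 i) //= /a mulfV // rmorph1 mul1r.
  by rewrite /w' opprK big_enum.
apply: vlt_sum => // j _; rewrite -[d]mul1r; apply: vle_lt_M; rewrite ?oner_neq0 //.
  by rewrite -(rmorph1 f) f_vle -(vle_pM2r _ _ c0) /a divfK // mul1r imax.
by rewrite vltBC; apply: (hr j).2; apply: vlt_le_trans xr (hr0 j).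
Qed.

End OpenIndependence.

(** * Lacunary perturbations *)

Lemma mmap_morph n (R S S' : comNzRingType) (g : {rmorphism R -> S})
    (h : 'I_n -> S) (phi : {rmorphism S -> S'}) (p : {mpoly R[n]}) :
  phi (mmap g h p) = mmap (phi \o g) (phi \o h) p.
Proof.
rewrite /mmap rmorph_sum; apply: eq_bigr => m _ /=.
by rewrite rmorphM /mmap1 rmorph_prod /=; congr (_ * _); apply: eq_bigr => i _; rewrite rmorphXn.
Qed.

Lemma mmap_id n (R : comNzRingType) (p : {mpoly R[n]}) :
  mmap (@mpolyC n R) (fun i => 'X_i) p = p.
Proof.
rewrite {2}[p]mpolyE /mmap; apply: eq_bigr => m _.
by rewrite mmap1_id mul_mpolyC.
Qed.

(* The N-th power dominates every coefficient of total degree below D. *)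
Lemma horner_lacunary_neq0 d (R : idomainType) (i0 : 'I_d) (a : {mpoly R[d]}) D :
  exists N, forall (c : R) (P : {poly {mpoly R[d]}}), c != 0 -> P != 0 ->
    (forall k, (msize P`_k <= D)%N) -> P.[a + c *: 'X_i0 ^+ N] != 0.
Proof.
exists (D + msize a)%N => c P c0 P0 hP; set N := (D + msize a)%N; set s := a + _.
have msN : msize s = N.+1.
  apply/eqP; rewrite eqn_leq; apply/andP; split.
    apply: leq_trans (msizeD_le _ _) _; rewrite geq_max msizeZ // mpolyXn msizeX.
    by rewrite mdegMn mdeg1 mul1n leqnn andbT ltnW // ltnS leq_addl.
  have -> : N = mdeg (U_(i0) *+ N)%MM by rewrite mdegMn mdeg1 mul1n.
  apply: msize_mdeg_lt; rewrite -[_ \in _]negbK -mcoeff_eq0 mcoeffD mcoeffZ mcoeffXn eqxx mulr1.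
  rewrite memN_msupp_eq0 ?add0r //; apply: msize_mdeg_ge.
  by rewrite mdegMn mdeg1 mul1n leq_addl.
have s0 : s != 0 by rewrite -msize_poly_eq0 msN.
have msX k : msize (s ^+ k) = (k * N).+1.
  elim: k => [|k IH]; first by rewrite expr0 msize1.
  by rewrite exprS msizeM ?expf_neq0 // msN IH mulSn addSn /= addnS.
rewrite horner_coef (polySpred P0) big_ord_recr /=.
set n := (size P).-1; have Pn0 : P`_n != 0 by rewrite -lead_coefE lead_coef_eq0.
rewrite addrC addr_eq0; apply/eqP => /(congr1 (fun p : {mpoly R[d]} => msize p)).
rewrite msizeN msizeM ?expf_neq0 // msX addnS /= => E.
(* The leading term has size msize P_n + n N, whereas the term of index i < n has size at most D + i
   N <= (i + 1) N <= n N. *)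
have : (msize P`_n + n * N <= n * N)%N.
  rewrite E; apply: leq_trans (msize_sum _ _ _) _; apply/bigmax_leqP => i _.
  have [->|Pi0] := eqVneq P`_i 0; first by rewrite mul0r msize0.
  rewrite msizeM ?expf_neq0 // msX addnS /=.
  apply: (@leq_trans (i.+1 * N)); last by rewrite leq_mul2r ltn_ord orbT.
  by rewrite mulSn leq_add2r (leq_trans (hP i)) // leq_addr.
by rewrite -[X in (_ <= X)%N]add0n leq_add2r leqNgt lt0n msize_poly_eq0 Pn0.
Qed.

(** * Monomials in x and in the two families of variables *)

Section TestPolynomials.
Variables (K : fieldType) (d m : nat).

Definition test_index D : finType := ('I_D * ('X_{1..m < D} * 'X_{1..d < D}))%type.

(** The inner d variables stand for t, the outer m variables for s, and the polynomial variable for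
    x; the index records the three exponents, each of degree less than D. *)
Definition test_poly D (i : test_index D) : {poly {mpoly {mpoly K[d]}[m]}} :=
  ('X_[i.2.2] *: 'X_[i.2.1])%:P * 'X^(i.1).

Definition test_comb D (c : test_index D -> K) : {poly {mpoly {mpoly K[d]}[m]}} :=
  \sum_i (c i)%:MP%:MP%:P * test_poly i.

Lemma test_index_eqE D (i k : test_index D) :
  [&& i.1 == k.1 :> nat, i.2.1 == k.2.1 :> 'X_{1..m} & i.2.2 == k.2.2 :> 'X_{1..d}] = (i == k).
Proof.
case: i k => [i [a b]] [k [a' b']] /=.
apply/and3P/eqP => [[/eqP Ei /eqP Ea /eqP Eb]|[-> -> ->]]; last by rewrite !eqxx.
by congr (_, (_, _)); apply: val_inj.
Qed.

Lemma test_comb_coef D c (k : nat) (a : 'X_{1..m}) (b : 'X_{1..d}) :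
  (@test_comb D c)`_k@_a@_b =
  \sum_(i : test_index D | [&& i.1 == k :> nat, i.2.1 == a :> 'X_{1..m} &
                              i.2.2 == b :> 'X_{1..d}]) c i.
Proof.
rewrite /test_comb coef_sum !raddf_sum [RHS]big_mkcond /=; apply: eq_bigr => i _.
rewrite /test_poly mulrA -polyCM coefCM coefXn eq_sym.
case: eqP => _ /=; last by rewrite mulr0 !mcoeff0.
rewrite mulr1 mcoeffCM mcoeffZ mcoeffX; case: eqP => _ /=; last by rewrite !mulr0 mcoeff0.
by rewrite mulr1 mcoeffCM mcoeffX; case: eqP => _; rewrite ?mulr1 ?mulr0.
Qed.

Lemma test_combP (P : {poly {mpoly {mpoly K[d]}[m]}}) :
  exists D, exists c, P = @test_comb D c.
Proof.
(* [D] is a crude sum exceeding every degree that occurs in P, in x and in either family of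
   variables. *)
pose A k := P`_k; pose D := (size P + \sum_(k < size P)
  (msize (A k) + \sum_(a <- msupp (A k)) msize (A k)@_a))%N.
exists D, (fun i : test_index D => P`_i.1@_(i.2.1)@_(i.2.2)).
apply/polyP => k; apply/mpolyP => a; apply/mpolyP => b; rewrite test_comb_coef.
have [z|nz] := eqVneq (P`_k@_a@_b) 0.
  by rewrite big1 // => i /and3P[/eqP-> /eqP-> /eqP->].
have Aa0 : (A k)@_a != 0 by apply: contraNneq nz; rewrite /A => ->; rewrite mcoeff0.
have Ak0 : A k != 0 by apply: contraNneq Aa0 => ->; rewrite mcoeff0.
have kP : (k < size P)%N by rewrite ltnNge; apply: contra Ak0 => kP; rewrite /A nth_default.
have kD : (k < D)%N by apply: leq_trans kP _; apply: leq_addr.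
have leD : (msize (A k) + \sum_(a <- msupp (A k)) msize (A k)@_a <= D)%N.
  apply: leq_trans (leq_addl _ _).
  by rewrite (bigD1 (Ordinal kP)) //= leq_addr.
have a_supp : a \in msupp (A k) by rewrite -[_ \in _]negbK -mcoeff_eq0.
have aD : (mdeg a < D)%N.
  by apply: leq_trans leD; apply: leq_trans (msize_mdeg_lt a_supp) (leq_addr _ _).
have bD : (mdeg b < D)%N.
  apply: leq_trans leD; apply: leq_trans (leq_addl _ _).
  rewrite (bigD1_seq a) ?msupp_uniq //=; apply: leq_trans (leq_addr _ _).
  by apply: msize_mdeg_lt; rewrite -[_ \in _]negbK -mcoeff_eq0.
pose i : test_index D := (Ordinal kD, (BMultinom aD, BMultinom bD)).
by rewrite (big_pred1 i); last by move=> l; apply: (test_index_eqE l i).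
Qed.

Lemma test_comb_coefE D c (i : test_index D) :
  (test_comb c)`_(i.1)@_(i.2.1)@_(i.2.2) = c i.
Proof.
by rewrite test_comb_coef; apply: big_pred1 => k; apply: test_index_eqE.
Qed.

(** The substituted value is constant in the m outer variables, so the coefficient of each outer
    monomial vanishes separately. Each such coefficient is the value of a polynomial over K[d], to
    which [horner_lacunary_neq0] applies. *)
Lemma test_comb_horner_neq0 (i0 : 'I_d) (s : {mpoly K[d]}) D :
  exists N, forall (c0 : K) (c : test_index D -> K), c0 != 0 ->
    (test_comb c).[(s + c0 *: 'X_i0 ^+ N)%:MP] = 0 -> forall i, c i = 0.
Proof.
have [N hN] := horner_lacunary_neq0 i0 s D; exists N => c0 c c00.
set s' := s + _ => Ps0 i; set P := test_comb c in Ps0.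
suff coef0 k a : P`_k@_a = 0 by rewrite -test_comb_coefE -/P coef0 mcoeff0.
pose Q : {poly {mpoly K[d]}} := \poly_(k < size P) P`_k@_a.
have QE j : Q`_j = P`_j@_a.
  by rewrite coef_poly; case: ltnP => // h; rewrite nth_default // mcoeff0.
rewrite -QE; suff -> : Q = 0 by rewrite coef0.
apply/eqP/negPn/negP => Q0.
have /negP : Q.[s'] != 0.
  apply: hN => // j; rewrite msizeE; apply/bigmax_leqP_seq => b bQ _; rewrite QE in bQ.
  rewrite ltnNge; apply/negP => Db; move: bQ; rewrite -[_ \in _]negbK -mcoeff_eq0.
  rewrite test_comb_coef big1 ?eqxx // => l /and3P[_ _ /eqP lb].
  by move: Db; rewrite -lb leqNgt bmdeg.
apply; rewrite (@horner_coef_wide _ (size P)) ?size_poly //; apply/eqP.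
transitivity (P.[s'%:MP]@_a); last by rewrite Ps0 mcoeff0.
rewrite horner_coef raddf_sum; apply: eq_bigr => j _ /=.
by rewrite QE -rmorphXn /= mulrC [P`_j * _]mulrC mcoeffCM.
Qed.

End TestPolynomials.

(** * The transcendental limit *)

Lemma smaller_in_base (K L M : valuedField) (e : vext K L) (j : vext L M) :
  immediate j -> (forall d : L, d != 0 -> exists2 c : K, c != 0 & vlt (e c) d) ->
  forall d : M, d != 0 -> exists2 c : K, c != 0 & vlt (j (e c)) d.
Proof.
move=> [val_onto _] small d d0; have [g Dg] := val_onto (vval d).
have [l l0 vl] := vval_surj g; have [c c0 ltc] := small l l0.
exists c => //; apply: (@vlt_le_trans _ (j l)); first by rewrite /vlt vext_vle.
by rewrite vleE ?fmorph_eq0 // vext_val // vl Dg lexx.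
Qed.

Section TranscendentalLimit.
Variables (K L M : valuedField) (e : vext K L) (j : vext L M).
Hypotheses (sphK : spherically_complete K) (sphM : spherically_complete M).
Hypothesis small : forall d : M, d != 0 -> exists2 c : K, c != 0 & vlt (j (e c)) d.
Variables (d m : nat) (t : 'I_d -> L) (s : 'I_m -> M) (i0 : 'I_d).
Hypotheses (t_indep : alg_independent e t) (s_indep : alg_independent j s).

Let f : {rmorphism K -> M} := (j \o e)%FUN.

Lemma comp_vle x y : vle (f x) (f y) = vle x y.
Proof. by rewrite /f /= !vext_vle. Qed.

Definition ev_L : {rmorphism {mpoly K[d]} -> L} := mmap e t.
Definition ev_M : {rmorphism {mpoly {mpoly K[d]}[m]} -> M} := mmap (j \o ev_L)%FUN s.

Lemma ev_M_C c : ev_M c%:MP = j (ev_L c).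
Proof. exact: mmapC. Qed.

Lemma ev_L_C c : ev_L c%:MP = e c.
Proof. exact: mmapC. Qed.

(** Evaluate coefficients in L first: independence of s over L kills each of these, then
    independence of t over K kills the coefficients of p. *)
Lemma ev_M_inj p : ev_M p = 0 -> p = 0.
Proof.
move=> p0; have : mmap j s (map_mpoly ev_L p) = 0.
  rewrite -[RHS]p0 /map_mpoly mmap_morph /=; apply: eq_bigr => a _ /=.
  by congr (_ * _); [rewrite /= mmapC | apply: mmap1_eq => i; rewrite /= mmapX mmap1U].
move/s_indep => /mpolyP q0; apply/mpolyP => a; rewrite mcoeff0.
by apply: t_indep; have := q0 a; rewrite mcoeff_map_mpoly mcoeff0.
Qed.

(** A finite stage of transcendence of x over K(t, s); being a finite linear independence, it is an
    open condition on x. *)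
Definition level D (x : M) :=
  lin_indep f (fun i : test_index d m D => (map_poly ev_M (test_poly K i)).[x]).

Lemma test_comb_eval D (c : test_index d m D -> K) x :
  (map_poly ev_M (test_comb c)).[x] = \sum_i f (c i) * (map_poly ev_M (test_poly K i)).[x].
Proof.
rewrite /test_comb rmorph_sum horner_sum; apply: eq_bigr => i _.
rewrite rmorphM hornerM; congr (_ * _); rewrite /= map_polyC hornerC.
exact: etrans (ev_M_C _) (congr1 j (ev_L_C _)).
Qed.

(** Adding a multiple of a high power of one t-variable gives a centre of level [D], and openness
    extends the level to a ball around it. *)
Lemma level_step D (a : {mpoly K[d]}) (r : M) : r != 0 ->
  exists a' r', [/\ r' != 0, vle r' r, vlt (ev_M a'%:MP - ev_M a%:MP) r &
    forall x, vlt (x - ev_M a'%:MP) r' -> level D x].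
Proof.
move=> r0; have [N hN] := test_comb_horner_neq0 m i0 a D.
pose X : M := ev_M ('X_i0 ^+ N)%:MP.
have X0 : X != 0.
  apply/eqP => /ev_M_inj /(congr1 (mcoeff 0)); rewrite mcoeff0 mcoeffC eqxx mulr1.
  by move/eqP; rewrite mpolyXn -msize_poly_eq0 msizeX.
(* The exponent N is fixed before [c], so [c] can be chosen small enough for c X to stay within
   radius r. *)
have [c c0 ltc] := small (mulf_neq0 r0 (invr_neq0 X0)).
pose a' := a + c *: 'X_i0 ^+ N.
have lev : level D (ev_M a'%:MP).
  move=> b; rewrite -test_comb_eval horner_map => /ev_M_inj; exact: hN.
have [r1 r10 hr1] := lin_indep_open comp_vle sphK lev.
have [r' r'0 [r'r r'r1]] := vle_min2 r0 r10.
exists a', r'; split=> // [|x xr]; last by apply/hr1/(vlt_le_trans xr).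
rewrite -rmorphB -rmorphB /a' addrC addKr -mul_mpolyC !rmorphM /= -/X.
by rewrite ev_M_C ev_L_C -[r](divfK X0) vlt_pM2r.
Qed.

(** Iterating [level_step] yields nested balls; a common point has every level. Any p over K[t, s]
    is a combination of test monomials for some D, so p(x) = 0 would force all its coefficients to
    vanish. *)
Lemma transcendental_limit : exists x : M, forall p : {poly M},
  p != 0 -> (forall i, exists a, ev_M a = p`_i) -> p.[x] != 0.
Proof.
have /choice[step hstep] (q : nat * ({mpoly K[d]} * M)) : exists q' : {mpoly K[d]} * M,
    q.2.2 != 0 -> [/\ q'.2 != 0, vle q'.2 q.2.2,
      vlt (ev_M q'.1%:MP - ev_M q.2.1%:MP) q.2.2 &
      forall x, vlt (x - ev_M q'.1%:MP) q'.2 -> level q.1 x].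
  (* The pair (0, 0) only makes [step] total; the radii that occur are never 0. *)
  case: q => D [a r] /=; have [->|r0] := eqVneq r 0; first by exists (0, 0).
  by have [a' [r' h]] := level_step D a r0; exists (a', r').
(* Each term consists of a centre, as a polynomial in t, and a radius; the ball of index n + 1 has
   level n. *)
pose fix u n := if n is k.+1 then step (k, u k) else (0, 1).
have u0 n : (u n).2 != 0.
  by elim: n => [|n IH]; rewrite ?oner_neq0 //; have [] := hstep (n, u n) IH.
pose B n x := vlt (x - ev_M (u n).1%:MP) (u n).2.
have BS n x : B n.+1 x -> B n x.
  have [_ le_r lt_a _] := hstep (n, u n) (u0 n); rewrite /B => Bx.
  rewrite -(subrKA (ev_M (u n.+1).1%:MP)); apply: vltD lt_a.
  exact: vlt_le_trans Bx le_r.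
have Ble n k x : (n <= k)%N -> B k x -> B n x.
  by move/subnK <-; elim: (k - n)%N => // i IH /BS.
have ballB : ball_chain B.
  split=> [n|n k|n a b c Bb Bc Ba].
  - by exists (ev_M (u n).1%:MP); rewrite /B subrr vlt0x.
  - by case/orP: (leq_total n k) => h; [right | left] => x; apply: Ble.
  - apply/negP => le_ab; apply: Ba; rewrite /B -(subrKA b); apply: vltD (Bb).
    rewrite vltBC; apply: vle_lt_trans le_ab _.
    by rewrite -(subrKA (ev_M (u n).1%:MP)); apply: vltD Bb _; rewrite vltBC.
have [x hx] := sphM ballB.
exists x => p p0 /choice[a ha]; apply: contraNneq p0 => px0.
have [D [c Dc]] := test_combP (\poly_(i < size p) a i).
have Dp : map_poly ev_M (test_comb c) = p.
  apply/polyP => i; rewrite coef_map -Dc coef_poly; case: ltnP => [_|ip].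
    exact: ha.
  by rewrite nth_default //; apply: rmorph0.
have [_ _ _ /(_ x (hx D.+1)) lev] := hstep (D, u D) (u0 D).
rewrite -Dp (_ : test_comb c = 0) ?rmorph0 // /test_comb big1 // => i _.
rewrite lev ?mul0r //.
by rewrite -test_comb_eval Dp.
Qed.

End TranscendentalLimit.

(** * Algebraic dependence *)

(** The n + 1 elements t, x satisfy a polynomial relation, reread as a polynomial in its last
    variable. [P] is nonzero before its coefficients are evaluated at t. *)
Lemma dependent_root (F E : fieldType) (f : {rmorphism F -> E}) n (t : 'I_n -> E) (x : E) :
  (forall k (t' : 'I_k -> E), alg_independent f t' -> (k <= n)%N) ->
  exists2 P : {poly {mpoly F[n]}}, P != 0 & (map_poly (mmap f t) P).[x] = 0.
Proof.
move=> maxn; pose t' i := if unlift ord_max i is Some k then t k else x.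
have [p [p0 pt]] : exists p : {mpoly F[n.+1]}, p != 0 /\ mmap f t' p = 0.
  apply: contrapT => nex; have := maxn n.+1 t'; rewrite ltnn => /(_ _)/notF; apply.
  by move=> p pt; apply/eqP/negPn/negP => p0; apply: nex; exists p.
pose h i : {poly {mpoly F[n]}} := if unlift ord_max i is Some k then ('X_k)%:P else 'X.
pose P := mmap (polyC \o @mpolyC n F)%FUN h p.
(* This map undoes the separation of the last variable, so P = 0 would give p = 0. *)
pose back : {rmorphism {poly {mpoly F[n]}} -> {mpoly F[n.+1]}} :=
  (horner_eval ('X_ord_max : {mpoly F[n.+1]}) \o
   map_poly (mmap (@mpolyC n.+1 F) (fun k => 'X_(lift ord_max k))))%FUN.
exists P.
  apply: contraNneq p0 => P0; rewrite -[p]mmap_id -[X in _ == X](rmorph0 back) -P0.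
  rewrite /P mmap_morph; apply/eqP; rewrite /mmap; apply: eq_bigr => a _.
  congr (_ * _); first by rewrite /= /horner_eval map_polyC hornerC; apply/esym/mmapC.
  apply: mmap1_eq => i; rewrite /= /horner_eval /h.
  case: unliftP => [k|] ->; last by rewrite map_polyX hornerX.
  by rewrite map_polyC hornerC; apply/esym/(etrans (mmapX _ _ _))/mmap1U.
pose eval : {rmorphism {poly {mpoly F[n]}} -> E} := (horner_eval x \o map_poly (mmap f t))%FUN.
rewrite -[LHS]/(eval P) /P mmap_morph -[RHS]pt /mmap; apply: eq_bigr => a _.
congr (_ * _); first by rewrite /= /horner_eval map_polyC hornerC; apply: mmapC.
apply: mmap1_eq => i; rewrite /= /horner_eval /h /t'.
case: unliftP => [k|] _; last by rewrite map_polyX hornerX.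
by rewrite map_polyC hornerC; apply: etrans (mmapX _ _ _) (mmap1U _ _).
Qed.

Lemma integral_sum (R S : comNzRingType) (g : {rmorphism R -> S}) (I : Type) (r : seq I)
  (F : I -> S) : (forall i, integralOver g (F i)) -> integralOver g (\sum_(i <- r) F i).
Proof. by move=> h; elim/big_ind: _ => //; [apply: integral0 | apply: integral_add]. Qed.

Lemma integral_prod (R S : comNzRingType) (g : {rmorphism R -> S}) (I : Type) (r : seq I)
  (F : I -> S) : (forall i, integralOver g (F i)) -> integralOver g (\prod_(i <- r) F i).
Proof. by move=> h; elim/big_ind: _ => //; [apply: integral1 | apply: integral_mul]. Qed.

Lemma integral_exp (R S : comNzRingType) (g : {rmorphism R -> S}) x n :
  integralOver g x -> integralOver g (x ^+ n).
Proof.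
move=> gx; elim: n => [|n IH]; first exact: integral1.
by rewrite exprS; apply: integral_mul.
Qed.

(** Polynomials in no variables are constants, so the relation given by [dependent_root] already has
    its coefficients in F. *)
Lemma trdeg0_algebraic (F E : fieldType) (f : {rmorphism F -> E}) (t : 'I_0 -> E) :
  (forall k (t' : 'I_k -> E), alg_independent f t' -> (k <= 0)%N) ->
  forall x, algebraicOver f x.
Proof.
move=> max0 x; have [P P0 Px] := dependent_root t x max0.
have cst (p : {mpoly F[0]}) : p = (p@_0)%:MP.
  apply/mpolyP => a; rewrite mcoeffC (_ : a = 0%MM) ?eqxx ?mulr1 //.
  by apply/mnmP => -[].
pose Q := map_poly (mcoeff 0%MM) P; have Qi i : Q`_i = P`_i@_0.
  by rewrite coef_map_id0 ?mcoeff0.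
exists Q.
  apply: contraNneq P0 => Q0; apply/eqP/polyP => i.
  by rewrite [P`_i]cst -Qi Q0 !coef0.
rewrite rootE -Px; apply/eqP; congr (_.[x]); apply/polyP => i.
by rewrite !coef_map /= [in RHS](cst P`_i) mmapC.
Qed.

(** * Algebraic elements over a subring *)

Record is_subring (M : pzRingType) (S : M -> Prop) : Prop := IsSubring {
  subring1 : S 1;
  subringB : forall x y, S x -> S y -> S (x - y);
  subringM : forall x y, S x -> S y -> S (x * y)
}.

Section FractionsOfSubring.
Variables (M : fieldType) (S : M -> Prop) (subS : is_subring S).

Lemma subring0 : S 0.
Proof. by rewrite -(subrr 1); apply: (subringB subS); apply: (subring1 subS). Qed.

Lemma subring_prod (I : Type) (r : seq I) (P : pred I) (F : I -> M) :
  (forall i, S (F i)) -> S (\prod_(i <- r | P i) F i).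
Proof.
by move=> SF; elim/big_ind: _ => // [|x y]; [apply: (subring1 subS) | apply: (subringM subS)].
Qed.

Definition frac_pred of is_subring S : {pred M} :=
  fun y => `[< exists a b, [/\ S a, S b, b != 0 & y = a / b] >].

Lemma frac_pred_divring : divring_closed (frac_pred subS).
Proof.
have [S1 SB SM] := subS; split.
- by apply/asboolP; exists 1, 1; rewrite oner_neq0 divr1.
- move=> _ _ /asboolP[a [b [Sa Sb b0 ->]]] /asboolP[c [d [Sc Sd d0 ->]]].
  apply/asboolP; exists (a * d - c * b), (b * d); split; [|exact: SM|exact: mulf_neq0|].
    by apply: SB; apply: SM.
  by field; rewrite ?b0 ?d0.
- move=> _ _ /asboolP[a [b [Sa Sb b0 ->]]] /asboolP[c [d [Sc Sd d0 ->]]].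
  apply/asboolP; have [->|c0] := eqVneq c 0.
    by exists 0, 1; rewrite oner_neq0 !mul0r invr0 mulr0; split=> //; apply: subring0.
  exists (a * d), (b * c); split; [exact: SM|exact: SM|exact: mulf_neq0|].
  by field; rewrite ?b0 ?c0 ?d0.
Qed.

HB.instance Definition _ :=
  GRing.isDivringClosed.Build M (frac_pred subS) frac_pred_divring.

Record frac_field := FracIn { frac_val : M; _ : frac_val \in frac_pred subS }.

HB.instance Definition _ := [isSub for frac_val].
HB.instance Definition _ := [Choice of frac_field by <:].
HB.instance Definition _ := [SubChoice_isSubIntegralDomain of frac_field by <:].
HB.instance Definition _ := [SubIntegralDomain_isSubField of frac_field by <:].

Definition frac_in : {rmorphism frac_field -> M} := val.

Lemma frac_integral a : S a -> integralOver frac_in a.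
Proof.
move=> Sa; have aP : a \in frac_pred subS.
  by apply/asboolP; exists a, 1; rewrite oner_neq0 divr1; split=> //; apply: (subring1 subS).
exact: (integral_id frac_in (FracIn aP)).
Qed.

(** An equation over the field of fractions is multiplied by the product of the denominators of its
    coefficients. *)
Lemma frac_root x : integralOver frac_in x ->
  exists2 p : {poly M}, p != 0 & (forall i, S p`_i) /\ p.[x] = 0.
Proof.
case/integral_algebraic => p p0 /eqP px; set q := map_poly frac_in p in px.
have q0 : q != 0 by rewrite map_poly_eq0.
have /choice[ab hab] i : exists ab : M * M, [/\ S ab.1, S ab.2, ab.2 != 0 & q`_i = ab.1 / ab.2].
  have /asboolP[a [b h]] : q`_i \in frac_pred subS by rewrite coef_map; apply: (valP p`_i).
  by exists (a, b).
pose b := \prod_(k < size q) (ab k).2.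
have b0 : b != 0 by apply/prodf_neq0 => k _; have [] := hab k.
exists (b *: q); first by rewrite scaler_eq0 (negPf b0).
split=> [i|]; last by rewrite hornerZ px mulr0.
rewrite coefZ; have [ip|pi] := ltnP i (size q); last first.
  by rewrite nth_default // mulr0; apply: subring0.
have [Sa _ bi0 ->] := hab i.
rewrite /b (bigD1 (Ordinal ip)) //= mulrC mulrA divfK //; apply: (subringM subS) => //.
by apply: subring_prod => k; have [] := hab k.
Qed.

End FractionsOfSubring.

(* L is algebraic over the subring S and S contains s, so M, being algebraic over
   L(s), is algebraic over S. *)
Lemma algebraic_over_subring (L M : fieldType) (j : {rmorphism L -> M}) m (s : 'I_m -> M)
    (S : M -> Prop) :
  is_subring S ->
  (forall l, exists2 p : {poly M}, p != 0 & (forall i, S p`_i) /\ p.[j l] = 0) ->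
  (forall i, S (s i)) -> alg_independent j s ->
  (forall k (s' : 'I_k -> M), alg_independent j s' -> (k <= m)%N) ->
  forall x, exists2 p : {poly M}, p != 0 & (forall i, S p`_i) /\ p.[x] = 0.
Proof.
move=> subS alg_L Ss s_indep s_max x; apply: (frac_root (subS := subS)).
have int_S := frac_integral subS.
have int_L l : integralOver (frac_in subS) (j l).
  have [p p0 [Sp pl]] := alg_L l; apply: (integral_root p0); first exact/eqP.
  by apply/integral_poly => i; apply: int_S.
have [G G0 Gx] := dependent_root s x s_max.
have G'0 : map_poly (mmap j s) G != 0.
  apply: contraNneq G0 => /polyP G0; apply/eqP/polyP => i; rewrite coef0.
  by apply: s_indep; have := G0 i; rewrite coef_map coef0.
apply: (integral_root G'0); first exact/eqP.
apply/integral_poly => i; rewrite coef_map /= /mmap.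
apply: (integral_sum (g := frac_in subS)) => a.
apply: integral_mul; first exact: int_L.
by apply: integral_prod => k; apply: integral_exp; apply: int_S.
Qed.

(** * Infinite transcendence degree and conclusion *)

Lemma maximal_infinite_trdeg (K L M : valuedField) (e : vext K L) (j : vext L M) :
  spherically_complete K -> spherically_complete M ->
  (forall d : M, d != 0 -> exists2 c : K, c != 0 & vlt (j (e c)) d) ->
  transcendental_ext e -> finite_trdeg e -> ~ finite_trdeg j.
Proof.
move=> sphK sphM small tr [d [[t t_indep] t_max]] [m [[s s_indep] s_max]].
(* L|K is transcendental, so its transcendence degree is positive and t has a member whose powers
   serve as perturbations. *)
have i0 : 'I_d.
  case: d t t_indep t_max => [|d] t _ t_max; last exact: ord0.
  by case: tr; apply: trdeg0_algebraic t t_max.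
have [x hx] := transcendental_limit sphK sphM small i0 t_indep s_indep.
(* S is the subring K[t, s] of M. Maximality of t and s makes all of M algebraic over S, whereas x
   is a root of no nonzero polynomial over S. *)
pose S y := exists a, ev_M e j t s a = y.
have subS : is_subring S.
  split; first by exists 1; apply: rmorph1.
    by move=> _ _ [a <-] [b <-]; exists (a - b); apply: rmorphB.
  by move=> _ _ [a <-] [b <-]; exists (a * b); apply: rmorphM.
have alg_L l : exists2 p : {poly M}, p != 0 & (forall i, S p`_i) /\ p.[j l] = 0.
  have [P P0 Pl] := dependent_root t l t_max.
  exists (map_poly j (map_poly (mmap e t) P)).
    rewrite map_poly_eq0; apply: contraNneq P0 => /polyP P0.
    apply/eqP/polyP => i; rewrite coef0.
    by apply: t_indep; have := P0 i; rewrite coef_map coef0.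
  split=> [i|]; last by rewrite horner_map /= Pl rmorph0.
  by exists (P`_i)%:MP; rewrite !coef_map; apply: ev_M_C.
have s_in i : S (s i) by exists 'X_i; apply: etrans (mmapX _ _ _) (mmap1U _ _).
have [p p0 [Sp px]] := algebraic_over_subring subS alg_L s_in s_indep s_max x.
by have := hx p p0 Sp; rewrite px eqxx.
Qed.

Theorem theorem1p6 (K L : valuedField) (e : vext K L) :
  maximal_valued K ->
  transcendental_ext e ->
  finite_trdeg e ->
  separable_algebraic_ext (vext_res e) ->
  torsion_group (vext_quot e) ->
  (forall p : nat, p \in [pchar (residue K)] ->
     forall (a : vext_quot e) (n : nat), is_order a n -> ~~ (p %| n)%N) ->
  (~ finite_ext (vext_res e) \/ ~ finite_group (vext_quot e)) /\
  (forall (M : valuedField) (j : vext L M),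
     immediate j -> maximal_valued M -> ~ finite_trdeg j).
Proof.
move=> maxK tr fin_tr sep tors _; split; first exact: transcendental_infinite.
have alg_res u : algebraicOver (vext_res e) u.
  by have [p [[p1 _] _ pu]] := sep u; exists p; rewrite // -size_poly_gt0 ltnW.
move=> M j imm maxM; apply: maximal_infinite_trdeg (tr) (fin_tr).
- exact: maximal_spherically_complete.
- exact: maximal_spherically_complete.
(* Values of K are cofinal in vL by torsion, and vL = vM since M|L is immediate. *)
by apply: (smaller_in_base imm) => d d0; apply: (exists_smaller tors alg_res tr d0).
Qed.
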